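(* There is a constant $N>0$ such that $$|\psi(\boldsymbol{x})|\le N\|\nabla v_1\|_{L^2(\mathbb{R}^2_+)}+\|v_1\|_{\mathcal{X}}\,(\ln x_2)^{1/2}\,\chi_{\{x_2>1\}}(x_2)$$ for every $\boldsymbol{x}=(x_1,x_2)\in\mathbb{R}^2_+$ and for every $\boldsymbol{v}=(v_1,v_2)\in\dot H^1_{0,\sigma}(\mathbb{R}^2_+)\cap\mathcal{X}$, where $\psi$ is the stream function associated with $\boldsymbol{v}$.
   Context: Let $\mathbb{R}^2_+=\{\boldsymbol{x}=(x_1,x_2)\in\mathbb{R}^2: x_2>0\}$. Let $C^\infty_{c,\sigma}(\mathbb{R}^2_+)$ be the set of compactly supported smooth vector fields $\boldsymbol{\varphi}:\mathbb{R}^2_+\to\mathbb{R}^2$ with $\nabla\cdot\boldsymbol{\varphi}=0$. The homogeneous Sobolev space is $\dot H^1(\mathbb{R}^2_+)=\{u\in L^1_{\mathrm{loc}}(\mathbb{R}^2_+):\nabla u\in L^2(\mathbb{R}^2_+)\}$ with semi-norm $\|\nabla u\|_{L^2(\mathbb{R}^2_+)}$. $\dot H^1_{0,\sigma}(\mathbb{R}^2_+)$ denotes the completion of $C^\infty_{c,\sigma}(\mathbb{R}^2_+)$ in $\dot H^1(\mathbb{R}^2_+)\times\dot H^1(\mathbb{R}^2_+)$; by Hardy's inequality the semi-norm is a norm on it, and its elements are identified with functions (limits $\boldsymbol v$ of sequences $\boldsymbol\varphi_k\in C^\infty_{c,\sigma}(\mathbb{R}^2_+)$ with $\nabla\boldsymbol\varphi_k\to\nabla\boldsymbol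 v$ in $L^2$ and $\boldsymbol\varphi_k\to\boldsymbol v$ in $L^2_{\mathrm{loc}}$). $\mathcal{X}=\big\{\boldsymbol{v}\in\dot H^1_{0,\sigma}(\mathbb{R}^2_+):\int_0^\infty x_2\|\boldsymbol{v}(\cdot,x_2)\|_{L^\infty(\mathbb{R})}^2\,dx_2<\infty\big\}$, and $\|v\|_{\mathcal{X}}=\big(\int_0^\infty x_2\|v(\cdot,x_2)\|_{L^\infty(\mathbb{R})}^2\,dx_2\big)^{1/2}$ (also used for scalar components $v$). For $\boldsymbol{v}=(v_1,v_2)\in\dot H^1_{0,\sigma}(\mathbb{R}^2_+)$ the associated stream function is $\psi(\boldsymbol{x})=\int_\Gamma(v_2\,dx-v_1\,dy)$, where $\Gamma$ is a continuous curve connecting $(0,0)$ and $\boldsymbol{x}=(x_1,x_2)$; since $\nabla\cdot\boldsymbol{v}=0$, $\psi$ is independent of the choice of $\Gamma$ and $\nabla^\perp\psi=(-\partial_2\psi,\partial_1\psi)=\boldsymbol{v}$ in $\mathbb{R}^2_+$. (For non-smooth $\boldsymbol v$: $\psi$ is the continuous function on $\overline{\mathbb{R}^2_+}$ with $\nabla^\perp\psi=\boldsymbol{v}$ and $\psi(0,0)=0$.) $\chi_{\{x_2>1\}}$ is the indicator function of $\{x_2>1\}$; the last term is $0$ when $x_2\le1$. *)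

(* Defs.v *)
From HB Require Import structures.
From mathcomp Require Import all_boot all_order all_algebra.
From mathcomp Require Import all_classical all_reals all_analysis.

Set Implicit Arguments.
Unset Strict Implicit.
Unset Printing Implicit Defensive.

Import Order.TTheory GRing.Theory Num.Theory.
Import numFieldNormedType.Exports.

Local Open Scope classical_set_scope.
Local Open Scope ring_scope.

Section defs.
Variable R : realType.
Implicit Types (u g f psi : R * R -> R) (v phi : R * R -> R * R).
Implicit Types (x e : R * R).

Definition half_plane : set (R * R) := [set x | 0 < x.2].

Definition closed_half_plane : set (R * R) := [set x | 0 <= x.2].

Definition leb2 := (@lebesgue_measure R \x @lebesgue_measure R)%E.

Definition e1 : R * R := (1, 0).
Definition e2 : R * R := (0, 1).

Definition comp1 v : R * R -> R := fun x => (v x).1.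
Definition comp2 v : R * R -> R := fun x => (v x).2.

Fixpoint Ck (n : nat) f : Prop :=
  continuous f /\
  if n is m.+1 then
    forall e, e = e1 \/ e = e2 ->
      (forall x, derivable f x e) /\ Ck m (fun x => 'D_e f x)
  else True.

Definition smooth f : Prop := forall n, Ck n f.

(* A compactly supported smooth function on the open half-plane is identified
   with its extension by zero, which is smooth on the whole plane. *)
Definition test_function f : Prop :=
  smooth f /\
  exists K : set (R * R),
    [/\ compact K, K `<=` half_plane & forall x, ~ K x -> f x = 0].

Definition Cc_sigma phi : Prop :=
  [/\ test_function (comp1 phi), test_function (comp2 phi) &
      forall x, 'D_e1 (comp1 phi) x + 'D_e2 (comp2 phi) x = 0].

(* Functions on the half-plane are represented by functions on the whole plane
   whose values outside the half-plane are irrelevant. *)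
Definition L1loc u : Prop :=
  forall K : set (R * R), compact K -> K `<=` half_plane ->
    leb2.-integrable K (fun x => (u x)%:E).

Definition is_weak_derivative e u g : Prop :=
  [/\ L1loc u, L1loc g &
      forall eta : R * R -> R, test_function eta ->
        \int[leb2]_(x in half_plane) (u x * 'D_e eta x) =
        - \int[leb2]_(x in half_plane) (g x * eta x)].

(* Weak derivatives are unique up to a null set; one representative is chosen
   (the value is meaningful only if a weak derivative exists). *)
Definition weak_derivative e u : R * R -> R :=
  xget (fun=> 0) [set g | is_weak_derivative e u g].

Definition L2normsq (D : set (R * R)) f : \bar R :=
  (\int[leb2]_(x in D) ((f x) ^+ 2)%:E)%E.

Definition grad_L2norm u : \bar R :=
  ((\int[leb2]_(x in half_plane)
      ((weak_derivative e1 u x) ^+ 2 + (weak_derivative e2 u x) ^+ 2)%:E)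
   `^ 2^-1)%E.

Definition Hdot1 u : Prop :=
  [/\ L1loc u,
      is_weak_derivative e1 u (weak_derivative e1 u),
      is_weak_derivative e2 u (weak_derivative e2 u) &
      (grad_L2norm u < +oo)%E].

Definition L2loc_cvg (u_ : nat -> R * R -> R) u : Prop :=
  forall K : set (R * R), compact K -> K `<=` half_plane ->
    L2normsq K (fun x => u_ k x - u x) @[k --> \oo] --> 0%E.

Definition grad_L2_cvg (u_ : nat -> R * R -> R) u : Prop :=
  forall e, e = e1 \/ e = e2 ->
    L2normsq half_plane (fun x => 'D_e (u_ k) x - weak_derivative e u x)
      @[k --> \oo] --> 0%E.

Definition Hdot1_0sigma : set (R * R -> R * R) :=
  [set v | [/\ Hdot1 (comp1 v), Hdot1 (comp2 v) &
     exists phi_ : nat -> R * R -> R * R,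
       [/\ forall k, Cc_sigma (phi_ k),
           grad_L2_cvg (fun k => comp1 (phi_ k)) (comp1 v),
           grad_L2_cvg (fun k => comp2 (phi_ k)) (comp2 v),
           L2loc_cvg (fun k => comp1 (phi_ k)) (comp1 v) &
           L2loc_cvg (fun k => comp2 (phi_ k)) (comp2 v)]]].

Definition slice_Linfty u (s : R) : \bar R :=
  ('N[@lebesgue_measure R]_+oo [EFin \o (fun t : R => u (t, s))])%E.

Definition Xnormsq u : \bar R :=
  (\int[@lebesgue_measure R]_(s in `]0%R, +oo[) (s%:E * (slice_Linfty u s) ^+ 2))%E.

Definition Xnorm u : \bar R := ((Xnormsq u) `^ 2^-1)%E.

Definition euclidean_norm v : R * R -> R :=
  fun x => Num.sqrt ((v x).1 ^+ 2 + (v x).2 ^+ 2).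

Definition Xspace : set (R * R -> R * R) :=
  Hdot1_0sigma `&` [set v | (Xnormsq (euclidean_norm v) < +oo)%E].

(* The derivatives in (- d_2 psi, d_1 psi) = v are weak ones. *)
Definition stream_function v psi : Prop :=
  [/\ {within closed_half_plane, continuous psi}, psi (0, 0) = 0,
      is_weak_derivative e2 psi (fun x => - comp1 v x) &
      is_weak_derivative e1 psi (comp2 v)].

End defs.

(* Main.v *)
Require Import Defs.
From HB Require Import structures.
From mathcomp Require Import all_boot all_order all_algebra.
From mathcomp Require Import all_classical all_reals all_analysis.
From mathcomp Require Import ess_sup_inf measurable_realfun.
From mathcomp Require Import ring lra.
Import Order.TTheory GRing.Theory Num.Theory.
Import numFieldNormedType.Exports.
Local Open Scope classical_set_scope.
Local Open Scope ring_scope.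

(** The stream function [psi] vanishes on the boundary of the half-plane, so
    [psi (y, h)] is, up to sign, the integral of the first component [v1] over
    the vertical segment from [(y, 0)] to [(y, h)]. The part of this segment
    below height one gives the gradient term, the part above it the logarithm.

    Below height one: the integral of [|v1|] over the unit segment above [y] is
    at most its mean over the unit segments above the points of [(y, y + 1)],
    plus the variation in the first variable. The mean is at most the integral
    of [|d_2 v1|] over a unit square, because [v1] vanishes at height zero; the
    variation is at most the integral of [|d_1 v1|] over that square. By
    Cauchy-Schwarz both are at most the norm of the gradient, whence the
    constant 2 ([approximable_line_bound]).

    Above height one: Cauchy-Schwarz with the weights [s] and [s^-1] bounds the
    integral of the slice norms of [v1] by the weighted norm times the square
    root of the integral of [s^-1] ([tail_bound]).

    Boundary values: the variation of [psi] between two points at the same small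
    height is the integral of the second component [v2] between them. Averaged
    over the heights in [[e, 2 * e]] it is at most a constant times [e^-1] times
    the integral of [|v2|] over a thin box, hence at most a constant times the
    integral of [|d_2 v2|] over a box of thickness [2 * e], since [v2] vanishes at
    height zero ([approximable_box_bound]). This tends to zero with [e], so [psi]
    is constant on the boundary ([eq_boundary]).

    Since [psi] has weak derivatives only, integrals along segments are replaced
    by averages of them over parallel segments: the weak derivative is tested
    against the product of a smooth averaging kernel in the transverse variable
    and of a plateau along the segment. The derivative of the plateau is a
    difference of two averaging kernels, one at each end, so that up to a small
    error the increment of the continuous function [psi] appears
    ([weak_derivative_increment]). The bounds on [v1] and [v2] are proved for test
    functions with the fundamental theorem of calculus and then passed to the
    limit ([approximable], [approximable_limit]). *)

(** * Smooth step functions of one variable *)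

Section smooth_functions.
Context {R : realType}.
Implicit Types (f g : R -> R) (x : R) (n k : nat).

(** The derivative is existentially quantified, which spares the computation of
    iterated derivatives in the closure properties below. *)
Fixpoint C1k n f : Prop :=
  if n is m.+1 then
    exists2 f' : R -> R, (forall x, is_derive x 1 f (f' x)) & C1k m f'
  else continuous f.

Definition smooth1 f : Prop := forall n, C1k n f.

Lemma is_derive_continuous f (f' : R -> R) :
  (forall x, is_derive x 1 f (f' x)) -> continuous f.
Proof.
move=> df x; apply: differentiable_continuous; apply/derivable1_diffP.
exact: (@ex_derive _ _ _ _ _ _ _ (df x)).
Qed.

Lemma C1kS n f : C1k n.+1 f -> C1k n f.
Proof.
elim: n f => [|n IHn] f [f' df kf]; first exact: is_derive_continuous df.
by exists f' => //; exact: IHn.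
Qed.

Lemma smooth1_continuous f : smooth1 f -> continuous f.
Proof. by move=> /(_ 0%N). Qed.

Lemma smooth1_is_derive f (f' : R -> R) :
  (forall x, is_derive x 1 f (f' x)) -> smooth1 f -> smooth1 f'.
Proof.
move=> df sf n; have [g dg kg] := sf n.+1.
rewrite (_ : f' = g)//; apply/funext => x.
by rewrite -(@derive_val _ _ _ _ _ _ _ (df x)) (@derive_val _ _ _ _ _ _ _ (dg x)).
Qed.

Lemma C1k_cst n (c : R) : C1k n (cst c).
Proof.
elim: n c => [|n IHn] c; first exact: cst_continuous.
by exists (cst 0) => // x; exact: is_derive_cst.
Qed.

Lemma C1kD n f g : C1k n f -> C1k n g -> C1k n (fun x => f x + g x).
Proof.
elim: n f g => [|n IHn] f g.
  by move=> cf cg x; apply: continuousD; [exact: cf|exact: cg].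
move=> [f' df kf] [g' dg kg]; exists (fun x => f' x + g' x); last exact: IHn.
by move=> x; exact: is_deriveD.
Qed.

Lemma C1kM n f g : C1k n f -> C1k n g -> C1k n (fun x => f x * g x).
Proof.
elim: n f g => [|n IHn] f g.
  by move=> cf cg x; apply: continuousM; [exact: cf|exact: cg].
move=> kf kg; have [kf1 kg1] := (@C1kS _ _ kf, @C1kS _ _ kg).
case: kf => f' df kf; case: kg => g' dg kg.
exists (fun x => f x * g' x + g x * f' x); last by apply: C1kD; exact: IHn.
by move=> x; exact: is_deriveM.
Qed.

Lemma C1kV n f : (forall x, f x != 0) -> C1k n f -> C1k n (fun x => (f x)^-1).
Proof.
move=> f0; elim: n => [|n IHn].
  by move=> cf x; apply: continuousV; [exact: f0|exact: cf].
move=> kf; have kf1 := @C1kS _ _ kf; case: kf => f' df kf.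
exists (fun x => -1 * ((f x)^-1 * (f x)^-1) * f' x).
  move=> x; apply: (is_derive_eq (is_deriveV (f0 x) (df x))).
  by rewrite /GRing.scale/= mulN1r expr2 invfM.
by apply: C1kM => //; apply: C1kM; [exact: C1k_cst|apply: C1kM; exact: IHn].
Qed.

Lemma C1k_affine n f (a b : R) : C1k n f -> C1k n (fun x => f (a * x + b)).
Proof.
elim: n f => [|n IHn] f.
  move=> cf x; apply: (@continuous_comp _ _ _ (fun x => a * x + b) f); last exact: cf.
  by apply: continuousD; [exact: mulrl_continuous|exact: cst_continuous].
case=> f' df kf; exists (fun x => f' (a * x + b) * a); last first.
  by apply: (C1kM _ (fun x => f' (a * x + b)) (cst a)); [exact: IHn|exact: C1k_cst].
move=> x; have dab : is_derive x 1 (fun x => a * x + b) a.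
  by apply: is_derive_eq; rewrite addr0 /GRing.scale/= mulr1.
exact: (is_derive1_comp (df _) dab).
Qed.

Lemma smooth1_cst (c : R) : smooth1 (cst c).
Proof. by move=> n; exact: C1k_cst. Qed.

Lemma smooth1D f g : smooth1 f -> smooth1 g -> smooth1 (fun x => f x + g x).
Proof. by move=> sf sg n; exact: C1kD. Qed.

Lemma smooth1M f g : smooth1 f -> smooth1 g -> smooth1 (fun x => f x * g x).
Proof. by move=> sf sg n; exact: C1kM. Qed.

Lemma smooth1V f : (forall x, f x != 0) -> smooth1 f -> smooth1 (fun x => (f x)^-1).
Proof. by move=> f0 sf n; exact: C1kV. Qed.

Lemma smooth1_affine f (a b : R) : smooth1 f -> smooth1 (fun x => f (a * x + b)).
Proof. by move=> sf n; exact: C1k_affine. Qed.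

(** The factor [x^-1 ^+ n] makes the family closed under differentiation, up to
    linear combinations, so that the smoothness of all its members is proved by
    a single induction. *)
Definition flat n x : R := if 0 < x then x^-1 ^+ n * expR (- x^-1) else 0.

Definition dflat n x : R := flat n.+2 x - n%:R * flat n.+1 x.

Lemma flat_ge0 n x : 0 <= flat n x.
Proof.
by rewrite /flat; case: ifP => // x0; rewrite mulr_ge0 ?expR_ge0 ?exprn_ge0 ?invr_ge0 ?ltW.
Qed.

Lemma flat_gt0 n x : 0 < x -> 0 < flat n x.
Proof. by move=> x0; rewrite /flat x0 mulr_gt0 ?expR_gt0 ?exprn_gt0 ?invr_gt0. Qed.

Lemma flat0 n x : x <= 0 -> flat n x = 0.
Proof. by move=> x0; rewrite /flat ltNge x0. Qed.

(** From the term of order [n.+2] of the exponential series at [x^-1]; the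
    factor [x ^+ 2] makes the derivative at zero vanish. *)
Lemma flat_le n x : 0 <= x -> flat n x <= x ^+ 2 * (n.+2)`!%:R.
Proof.
rewrite le_eqVlt => /predU1P[<-|x0].
  by rewrite flat0// expr0n mul0r.
have y0 : 0 < x^-1 by rewrite invr_gt0.
have := @expR_ge1Dxn R _ n.+1 (ltW y0).
have f0 : 0 < (n.+2)`!%:R :> R by rewrite ltr0n fact_gt0.
have e0 := expR_gt0 (x^-1).
rewrite /flat x0 expRN; move: (expR x^-1) e0 => e e0.
move=> h; have {}h : x^-1 ^+ n.+2 / (n.+2)`!%:R <= e by lra.
move: h; rewrite ler_pdivrMr// => h.
rewrite ler_pdivrMr//.
have -> : x^-1 ^+ n = x ^+ 2 * x^-1 ^+ n.+2.
  by rewrite !exprS; field; rewrite gt_eqF.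
by rewrite -[leRHS]mulrA ler_pM2l ?exprn_gt0// mulrC.
Qed.

Lemma is_derive_flat n x : is_derive x 1 (flat n) (dflat n x).
Proof.
have [x0|x0|->] := ltrgt0P x.
- pose g y : R := y^-1 ^+ n * expR (- y^-1).
  apply: (@near_eq_is_derive _ _ _ g).
    near=> y; rewrite /flat /g ifT//; near: y; exact: lt_nbhsr.
  have xn0 : id x != 0 by rewrite gt_eqF.
  have dV := is_deriveV xn0 (is_derive_id x 1).
  have dX := is_deriveX n dV.
  have dE := @is_derive1_comp _ expR (fun y => - y^-1) _ _ _
    (is_derive_expR (- x^-1)) (is_deriveN dV).
  have -> : g = GRing.inv ^+ n * (expR \o (fun y : R => - y^-1)).
    by apply/funext => y; rewrite /g !fctE.
  apply: (is_derive_eq (is_deriveM dX dE)); rewrite !fctE.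
  rewrite /dflat /flat x0 /GRing.scale/= !mulr1.
  by case: n {g dX} => [|n]; rewrite /= !exprS; field; rewrite gt_eqF.
- apply: (@near_eq_is_derive _ _ _ (cst 0)).
    near=> y; rewrite flat0//; apply: ltW; near: y; exact: lt_nbhsl.
  by rewrite /dflat !flat0 ?ltW// mulr0 subr0; exact: is_derive_cst.
- rewrite /dflat !flat0// mulr0 subr0.
  suff h : h^-1 *: (flat n (h *: 1 + 0) - flat n 0) @[h --> 0^'] --> (0 : R).
    apply: DeriveDef; first by apply/cvg_ex; exists 0.
    by apply/cvg_lim.
  apply/cvgrPdist_le => /= e e0; near=> h.
  have h0 : h != 0 by near: h; exact: nbhs_dnbhs_neq.
  rewrite sub0r normrN (flat0 _ 0)// subr0 /GRing.scale/= mulr1 addr0 normrM.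
  have [hn|hp] := leP h 0; first by rewrite flat0// normr0 mulr0 ltW.
  rewrite gtr0_norm ?invr_gt0// ger0_norm ?flat_ge0// ler_pdivrMl//.
  apply: (le_trans (flat_le n _ (ltW hp))).
  rewrite expr2 -mulrA ler_pM2l// -ler_pdivlMr ?ltr0n ?fact_gt0//.
  apply: le_trans (ler_norm _) _.
  near: h; apply: dnbhs0_le; rewrite divr_gt0// ltr0n fact_gt0//.
Unshelve. all: by end_near. Qed.

Lemma smooth1_flat n : smooth1 (flat n).
Proof.
move=> k; elim: k n => [|k IHk] n.
  exact: is_derive_continuous (is_derive_flat n).
exists (dflat n); first exact: is_derive_flat.
apply: (C1kD _ _ (fun x => - (n%:R * flat n.+1 x))) => //.
rewrite (_ : (fun x => _) = (fun x => cst (- n%:R) x * flat n.+1 x)).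
  by apply: C1kM; [exact: C1k_cst|exact: IHk].
by apply/funext => x; rewrite mulNr.
Qed.

(** The sets where the two terms of the denominator are positive cover the line. *)
Definition step x : R := flat 0 (x - 1) / (flat 0 (x - 1) + flat 0 (2 - x)).

Definition dstep x : R :=
  (flat 2 (x - 1) * flat 0 (2 - x) + flat 0 (x - 1) * flat 2 (2 - x)) /
  (flat 0 (x - 1) + flat 0 (2 - x)) ^+ 2.

Lemma step_denom_gt0 x : 0 < flat 0 (x - 1) + flat 0 (2 - x).
Proof.
have [x1|x1] := leP x 1.
  by apply: ltr_wpDl; [exact: flat_ge0|apply: flat_gt0; lra].
by apply: ltr_pwDl; [apply: flat_gt0; lra|exact: flat_ge0].
Qed.

Lemma smooth1_step : smooth1 step.
Proof.
have sa : smooth1 (fun x => flat 0 (x - 1)).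
  rewrite (_ : (fun x => _) = (fun x => flat 0 (1 * x + -1))).
    exact/smooth1_affine/smooth1_flat.
  by apply/funext => x; rewrite mul1r.
have sb : smooth1 (fun x => flat 0 (2 - x)).
  rewrite (_ : (fun x => _) = (fun x => flat 0 (-1 * x + 2))).
    exact/smooth1_affine/smooth1_flat.
  by apply/funext => x; rewrite mulN1r addrC.
apply: smooth1M => //; apply: smooth1V; last exact: smooth1D.
by move=> x; rewrite gt_eqF// step_denom_gt0.
Qed.

Lemma is_derive_step x : is_derive x 1 step (dstep x).
Proof.
have da : is_derive x 1 (fun x => flat 0 (x - 1)) (flat 2 (x - 1)).
  apply: is_derive_eq.
    by apply: (@is_derive1_comp _ (flat 0) (fun x => x - 1)); exact: is_derive_flat.
  by rewrite /dflat mul0r !subr0 mulr1.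
have db : is_derive x 1 (fun x => flat 0 (2 - x)) (- flat 2 (2 - x)).
  apply: is_derive_eq.
    by apply: (@is_derive1_comp _ (flat 0) (fun x => 2 - x)); exact: is_derive_flat.
  by rewrite /dflat mul0r subr0 add0r mul1r mulrN1.
have d0 := step_denom_gt0 x.
apply: is_derive_eq.
  apply: (@is_deriveM _ _ (fun x => flat 0 (x - 1))
           (fun x => (flat 0 (x - 1) + flat 0 (2 - x))^-1)).
  by apply: is_deriveV; rewrite gt_eqF.
rewrite /dstep /GRing.scale/=; field.
by rewrite gt_eqF.
Qed.

Lemma smooth1_dstep : smooth1 dstep.
Proof. exact: smooth1_is_derive is_derive_step smooth1_step. Qed.

Lemma step_ge0 x : 0 <= step x.
Proof. by rewrite divr_ge0 ?flat_ge0// ltW// step_denom_gt0. Qed.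

Lemma step_le1 x : step x <= 1.
Proof. by rewrite ler_pdivrMr ?step_denom_gt0// mul1r lerDl flat_ge0. Qed.

Lemma step_eq0 x : x <= 1 -> step x = 0.
Proof. by move=> x1; rewrite /step flat0 ?mul0r// subr_le0. Qed.

Lemma step_eq1 x : 2 <= x -> step x = 1.
Proof.
move=> x2; rewrite /step (@flat0 _ (2 - x)) ?subr_le0// addr0 divff// gt_eqF//.
by apply: flat_gt0; lra.
Qed.

Lemma dstep_ge0 x : 0 <= dstep x.
Proof.
by rewrite divr_ge0 ?sqr_ge0// addr_ge0// mulr_ge0 ?flat_ge0.
Qed.

Lemma dstep_eq0 x : ~~ (1 <= x <= 2) -> dstep x = 0.
Proof.
rewrite negb_and -!ltNge /dstep => /orP[x1|x2].
  by rewrite !(@flat0 _ (x - 1)) ?subr_le0 ?ltW// !mul0r addr0 mul0r.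
by rewrite !(@flat0 _ (2 - x)) ?subr_le0 ?ltW// !mulr0 addr0 mul0r.
Qed.

Lemma dstep_bounded : exists2 C : R, 0 < C & forall x, dstep x <= C.
Proof.
have [|c _ hc] := @EVT_max R dstep 1 2 (ler1n _ 2).
  exact/continuous_subspaceT/smooth1_continuous/smooth1_dstep.
exists (dstep c + 1) => [|x]; first by rewrite ltr_wpDl ?dstep_ge0.
have [xI|xI] := boolP (1 <= x <= 2).
  by rewrite (le_trans (hc _ _)) ?lerDl// in_itv.
by rewrite dstep_eq0// addr_ge0 ?dstep_ge0.
Qed.

End smooth_functions.

(** * Test functions of product form *)

Section test_functions.
Context {R : realType}.
Implicit Types (F : R * R -> R) (f g : R -> R) (x : R * R) (t s : R).

(** Partial derivatives are directional derivatives in the plane, that is,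
    limits of these slopes; the identity reduces them to derivatives of
    functions of one variable. *)
Lemma slope_e1 F (x : R * R) :
  (fun h : R => h^-1 *: ((F \o shift x) (h *: @e1 R) - F x)) =
  (fun h : R => h^-1 *: (((fun t => F (t, x.2)) \o shift x.1) (h *: 1) -
    (fun t => F (t, x.2)) x.1)).
Proof.
apply/funext => h /=; case: x => a b /=.
rewrite (_ : h *: @e1 R + (a, b) = (h *: 1 + a, b))//.
by rewrite /e1 -[LHS]/(h * 1 + a, h * 0 + b) mulr0 add0r.
Qed.

Lemma slope_e2 F (x : R * R) :
  (fun h : R => h^-1 *: ((F \o shift x) (h *: @e2 R) - F x)) =
  (fun h : R => h^-1 *: (((fun s => F (x.1, s)) \o shift x.2) (h *: 1) -
    (fun s => F (x.1, s)) x.2)).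
Proof.
apply/funext => h /=; case: x => a b /=.
rewrite (_ : h *: @e2 R + (a, b) = (a, h *: 1 + b))//.
by rewrite /e2 -[LHS]/(h * 0 + a, h * 1 + b) mulr0 add0r.
Qed.

Lemma derive_e1E F x : 'D_(@e1 R) F x = 'D_1 (fun t : R => F (t, x.2)) x.1.
Proof. by rewrite /derive slope_e1. Qed.

Lemma derive_e2E F x : 'D_(@e2 R) F x = 'D_1 (fun s => F (x.1, s)) x.2.
Proof. by rewrite /derive slope_e2. Qed.

Lemma derivable_e1E F x :
  derivable F x (@e1 R) = derivable (fun t => F (t, x.2)) x.1 1.
Proof. by rewrite /derivable slope_e1. Qed.

Lemma derivable_e2E F x :
  derivable F x (@e2 R) = derivable (fun s => F (x.1, s)) x.2 1.
Proof. by rewrite /derivable slope_e2. Qed.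

Lemma continuous_section1 F s : continuous F -> continuous (fun t => F (t, s)).
Proof.
move=> cF t; apply: (@continuous_comp _ _ _ (fun t => (t, s)) F); last exact: cF.
exact: (cvg_pair cvg_id (cvg_cst _)).
Qed.

Lemma continuous_section2 F t : continuous F -> continuous (fun s => F (t, s)).
Proof.
move=> cF s; apply: (@continuous_comp _ _ _ (fun s => (t, s)) F); last exact: cF.
exact: (cvg_pair (cvg_cst _) cvg_id).
Qed.

Definition tensor f g : R * R -> R := fun x => f x.1 * g x.2.

Lemma is_derive_tensor1 f g (f' : R -> R) x : (forall t : R, is_derive t 1 f (f' t)) ->
  is_derive x (@e1 R) (tensor f g) (tensor f' g x).
Proof.
move=> df; have h : is_derive x.1 1 (fun t => tensor f g (t, x.2)) (tensor f' g x).
  rewrite /tensor/=; apply: is_derive_eq.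
  by rewrite scaler0 add0r /GRing.scale/= mulrC.
apply: DeriveDef.
  by rewrite derivable_e1E; exact: (@ex_derive _ _ _ _ _ _ _ h).
by rewrite derive_e1E; exact: (@derive_val _ _ _ _ _ _ _ h).
Qed.

Lemma is_derive_tensor2 f g (g' : R -> R) x : (forall t : R, is_derive t 1 g (g' t)) ->
  is_derive x (@e2 R) (tensor f g) (tensor f g' x).
Proof.
move=> dg; have h : is_derive x.2 1 (fun t => tensor f g (x.1, t)) (tensor f g' x).
  rewrite /tensor/=; apply: is_derive_eq.
  by rewrite /GRing.scale.
apply: DeriveDef.
  by rewrite derivable_e2E; exact: (@ex_derive _ _ _ _ _ _ _ h).
by rewrite derive_e2E; exact: (@derive_val _ _ _ _ _ _ _ h).
Qed.

Lemma derive_tensor1 f g (f' : R -> R) : (forall t : R, is_derive t 1 f (f' t)) ->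
  (fun x => 'D_(@e1 R) (tensor f g) x) = tensor f' g.
Proof.
by move=> df; apply/funext => x; apply: (@derive_val _ _ _ _ _ _ _ (is_derive_tensor1 _ _ _ x df)).
Qed.

Lemma derive_tensor2 f g (g' : R -> R) : (forall t : R, is_derive t 1 g (g' t)) ->
  (fun x => 'D_(@e2 R) (tensor f g) x) = tensor f g'.
Proof.
by move=> dg; apply/funext => x; apply: (@derive_val _ _ _ _ _ _ _ (is_derive_tensor2 _ _ _ x dg)).
Qed.

Lemma continuous_tensor f g : continuous f -> continuous g -> continuous (tensor f g).
Proof.
move=> cf cg x; apply: (@continuousM _ _ (fun x => f x.1) (fun x => g x.2)).
  by apply: (@continuous_comp _ _ _ fst f); [exact: cvg_fst|exact: cf].
by apply: (@continuous_comp _ _ _ snd g); [exact: cvg_snd|exact: cg].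
Qed.

Lemma smooth_tensor f g : smooth1 f -> smooth1 g -> smooth (tensor f g).
Proof.
move=> sf sg n; elim: n f g sf sg => [|n IHn] f g sf sg.
  by split => //; apply: continuous_tensor; exact: smooth1_continuous.
split; first by apply: continuous_tensor; exact: smooth1_continuous.
have [f' df _] := sf 1%N; have [g' dg _] := sg 1%N.
move=> e [|] ->.
  split=> [x|]; first exact: (@ex_derive _ _ _ _ _ _ _ (is_derive_tensor1 _ _ _ x df)).
  rewrite (derive_tensor1 _ _ _ df); apply: IHn => //.
  exact: smooth1_is_derive df sf.
split=> [x|]; first exact: (@ex_derive _ _ _ _ _ _ _ (is_derive_tensor2 _ _ _ x dg)).
rewrite (derive_tensor2 _ _ _ dg); apply: IHn => //.
exact: smooth1_is_derive dg sg.
Qed.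

Definition box (a b c d : R) : set (R * R) :=
  [set x | a <= x.1 <= b /\ c <= x.2 <= d].

Lemma boxE a b c d : box a b c d = `[a, b]%classic `*` `[c, d]%classic.
Proof. by apply/seteqP; split => x; rewrite /box /= !in_itv. Qed.

Lemma compact_box a b c d : compact (box a b c d).
Proof. by rewrite boxE; apply: compact_setX; exact: segment_compact. Qed.

Lemma box_half_plane a b c d : 0 < c -> box a b c d `<=` @half_plane R.
Proof. by move=> c0 x [_ /andP[cx _]]; exact: lt_le_trans cx. Qed.

Lemma test_function_tensor f g a b c d : smooth1 f -> smooth1 g -> 0 < c ->
  (forall t, ~~ (a <= t <= b) -> f t = 0) ->
  (forall s, ~~ (c <= s <= d) -> g s = 0) -> test_function (tensor f g).
Proof.
move=> sf sg c0 f0 g0; split; first exact: smooth_tensor.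
exists (box a b c d); split; [exact: compact_box|exact: box_half_plane|].
move=> x xB; rewrite /tensor; have [xab|/f0->] := boolP (a <= x.1 <= b); last by rewrite mul0r.
by have [xcd|/g0->] := boolP (c <= x.2 <= d); [exfalso; exact: xB|rewrite mulr0].
Qed.

Section test_function_theory.
Variable phi : R * R -> R.
Hypothesis tphi : test_function phi.

Lemma test_function_continuous : continuous phi.
Proof. by have [/(_ 0%N)[]] := tphi. Qed.

Lemma test_function_continuous_derive e : e = @e1 R \/ e = @e2 R ->
  continuous (fun x => 'D_e phi x).
Proof. by move=> he; have [/(_ 1%N)[_ /(_ e he)[_ []]]] := tphi. Qed.

Lemma test_function_is_derive1 t s :
  is_derive t 1 (fun t => phi (t, s)) ('D_(@e1 R) phi (t, s)).
Proof.
have [/(_ 1%N)[_ /(_ (@e1 R) (or_introl erefl))[dphi _]] _] := tphi.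
apply: DeriveDef; last by rewrite derive_e1E.
by have := dphi (t, s); rewrite derivable_e1E.
Qed.

Lemma test_function_is_derive2 t s :
  is_derive s 1 (fun s => phi (t, s)) ('D_(@e2 R) phi (t, s)).
Proof.
have [/(_ 1%N)[_ /(_ (@e2 R) (or_intror erefl))[dphi _]] _] := tphi.
apply: DeriveDef; last by rewrite derive_e2E.
by have := dphi (t, s); rewrite derivable_e2E.
Qed.

Lemma test_function_eq0 x : x.2 <= 0 -> phi x = 0.
Proof.
have [_ [K [_ KH K0]]] := tphi; move=> x0; apply: K0 => /KH.
by rewrite /half_plane/= ltNge x0.
Qed.

End test_function_theory.
End test_functions.

(** * Integration *)

Section integrals.
Context d (T : measurableType d) (R : realType) (mu : {measure set T -> \bar R}).
Local Open Scope ereal_scope.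

(** The integral of a nonnegative function is a supremum over the simple
    functions below it, so it is monotone even without measurability. This
    permits a comparison with the weighted norm without a study of how the slice
    norms depend on the height. *)
Lemma ge0_le_integral_nonmeasurable (D : set T) (f g : T -> \bar R) :
  (forall x, D x -> 0 <= f x) -> (forall x, D x -> f x <= g x) ->
  \int[mu]_(x in D) f x <= \int[mu]_(x in D) g x.
Proof.
move=> f0 fg; rewrite !ge0_integralE//; last first.
  by move=> x Dx; exact: le_trans (f0 _ Dx) (fg _ Dx).
apply: le_ereal_sup => _ [h hf <-]; exists h => // x.
apply: (le_trans (hf x)); rewrite !patchE; case: ifPn => // /set_mem Dx.
exact: fg.
Qed.

(** Bounds [A] and [B] on the norms, instead of the norms themselves, let the
    inequality follow from [y <= A / B / 2 + B / A / 2 * y ^+ 2] by integration. *)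
Lemma integral_cauchy_schwarz (D : set T) (f : T -> R) (A B : R) :
  measurable D -> measurable_fun D f -> (0 < A)%R -> (0 < B)%R ->
  \int[mu]_(x in D) ((f x) ^+ 2)%:E <= (A ^+ 2)%:E -> mu D <= (B ^+ 2)%:E ->
  \int[mu]_(x in D) `|f x|%:E <= (A * B)%:E.
Proof.
move=> mD mf A0 B0 fA DB.
have mf2 : measurable_fun D (fun x => (f x ^+ 2)%:E).
  by apply/measurable_EFinP; exact: measurable_funX.
apply: (@le_trans _ _ (\int[mu]_(x in D)
    ((A / B / 2)%:E + (B / A / 2)%:E * ((f x) ^+ 2)%:E))).
  apply: ge0_le_integral => //.
  - by apply/measurable_EFinP; exact: measurableT_comp.
  - by apply: emeasurable_funD => //; exact: emeasurable_funM.
  - move=> x _; rewrite -EFinM -EFinD lee_fin.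
    rewrite -(real_normK (num_real (f x))); move: `|f x|%R => y.
    rewrite -subr_ge0.
    have -> : (A / B / 2 + B / A / 2 * y ^+ 2 - y = (A - B * y) ^+ 2 / (A * B * 2))%R.
      by field; rewrite !gt_eqF.
    by rewrite divr_ge0 ?sqr_ge0// !mulr_ge0// ltW.
have p1 : (0 <= A / B / 2)%R by rewrite !divr_ge0// ltW.
have p2 : (0 <= B / A / 2)%R by rewrite !divr_ge0// ltW.
rewrite ge0_integralD//; last 2 first.
- by move=> x _; rewrite -EFinM lee_fin mulr_ge0// sqr_ge0.
- exact: emeasurable_funM.
rewrite integral_cst// ge0_integralZl//; last first.
  by move=> x _; rewrite lee_fin sqr_ge0.
have -> : (A * B = A / B / 2 * B ^+ 2 + B / A / 2 * A ^+ 2)%R.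
  by field; rewrite !gt_eqF.
by rewrite EFinD !EFinM leeD// lee_pmul// ?integral_ge0// => *; rewrite lee_fin sqr_ge0.
Qed.

End integrals.

Section plane.
Context {R : realType}.
Local Notation mu := (@lebesgue_measure R).
Local Notation mu2 := (@lebesgue_measure R \x @lebesgue_measure R)%E.
Local Notation T1 := (measurableTypeR R).
Local Notation T2 := (measurableTypeR R * measurableTypeR R)%type.

Section measure_theory.

(** An open set is a countable union of products of balls with rational centres
    and radii [n.+1%:R^-1]. *)
Lemma open_measurable2 (O : set (R * R)) :
  open O -> @measurable _ T2 O.
Proof.
move=> oO.
pose B (i : rat * rat * nat) : set T2 :=
  ball (ratr i.1.1 : R) (i.2.+1%:R^-1) `*` ball (ratr i.1.2 : R) (i.2.+1%:R^-1).
rewrite (_ : O = \bigcup_i (if `[< B i `<=` O >] then B i else set0)); last first.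
  apply/seteqP; split => [p Op|p [i _]]; last by case: asboolP => // + Bp; exact.
  have [e /= e0 pe] : exists2 e : R, 0 < e & ball p e `<=` O.
    by apply/nbhs_ballP; exact: open_nbhs_nbhs.
  have [n _ ne] : exists2 n : nat, True & n.+1%:R^-1 < e / 2.
    have [n] := near_infty_natSinv_lt (PosNum (divr_gt0 e0 (ltr0n R 2))).
    by move=> _ /(_ n (leqnn n)) /= h; exists n.
  have n0 : 0 < n.+1%:R^-1 :> R by rewrite invr_gt0.
  have rat_near (a : R) : exists q : rat, `|ratr q - a| < n.+1%:R^-1.
    have [|q] := @rat_in_itvoo R (a - n.+1%:R^-1) (a + n.+1%:R^-1).
      by rewrite (lt_trans (_ : _ < a)) ?gtrBl ?ltrDl.
    by rewrite in_itv/= -ltr_distl; exists q.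
  have [q1 h1] := rat_near p.1; have [q2 h2] := rat_near p.2.
  exists ((q1, q2), n) => //; case: asboolP => [_|]; first by split.
  case=> x [x1 x2]; apply: pe.
  split; rewrite -ball_normE/=.
    rewrite distrC (le_lt_trans (ler_distD (ratr q1) _ _))//.
    by rewrite [ltRHS](splitr e) ltrD ?(lt_trans _ ne)// distrC.
  rewrite distrC (le_lt_trans (ler_distD (ratr q2) _ _))//.
  by rewrite [ltRHS](splitr e) ltrD ?(lt_trans _ ne)// distrC.
apply: countable_bigcupT_measurable; first exact: countableP.
move=> i; case: asboolP => _ //.
by apply: measurableX; exact: measurable_ball.
Qed.

Lemma continuous_measurable2 (F : R * R -> R) : continuous F ->
  @measurable_fun _ _ T2 T1 setT F.
Proof.
move=> cF; apply: (measurability _ (RGenOInfty.measurableE R)).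
move=> /= _ [_ [x ->] <-]; rewrite setTI; apply: open_measurable2.
by move/continuousP : cF; apply; exact: interval_open.
Qed.

Lemma measurable_half_plane : @measurable _ T2 (@half_plane R).
Proof.
rewrite (_ : @half_plane R = [set: T1] `*` (`]0, +oo[%classic : set T1)).
  exact: measurableX.
by apply/seteqP; split => x /=; rewrite in_itv/= andbT; [split|case].
Qed.

Lemma measurable_box (a b c d : R) : @measurable _ T2 (box a b c d).
Proof. by rewrite boxE; apply: measurableX; exact: measurable_itv. Qed.

Lemma half_plane_bigcup :
  @half_plane R = \bigcup_n box (- n%:R) n%:R n.+1%:R^-1 n%:R.
Proof.
apply/seteqP; split => [x x0|x [n _]]; last by apply: box_half_plane; rewrite invr_gt0.
have [n1 h1] : exists n : nat, `|x.1| < n%:R by eexists; exact: archi_boundP.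
have [n2 h2] : exists n : nat, `|x.2| < n%:R by eexists; exact: archi_boundP.
have [n3 h3] : exists n : nat, `|x.2^-1| < n%:R by eexists; exact: archi_boundP.
exists (n1 + n2 + n3)%N => //.
have ? : 0 <= n1%:R :> R by [].
have ? : 0 <= n2%:R :> R by [].
have ? : 0 <= n3%:R :> R by [].
move: h1 h2 h3; rewrite !ltr_norml => /andP[? ?] /andP[? ?] /andP[? h].
split; rewrite !natrD; apply/andP; split; try lra.
rewrite -[leRHS]invrK lef_pV2 ?posrE ?invr_gt0//.
by rewrite -addn1 !natrD; lra.
Qed.

(** Local integrability says something on each compact set only, whence the
    exhaustion of the half-plane by boxes. *)
Lemma L1loc_measurable (u : R * R -> R) : L1loc u ->
  @measurable_fun _ _ T2 T1 (@half_plane R) u.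
Proof.
move=> lu; rewrite half_plane_bigcup; apply/measurable_fun_bigcup => n.
  exact: measurable_box.
have := lu _ (compact_box (- n%:R) n%:R n.+1%:R^-1 n%:R).
move=> /(_ (@box_half_plane _ _ _ _ _ _)).
rewrite invr_gt0 => /(_ (ltr0Sn _ _)) /measurable_int/measurable_EFinP.
exact.
Qed.

End measure_theory.

Section fubini.
Local Open Scope ereal_scope.
Variables (A B : set T1) (f : T2 -> \bar R).
Hypotheses (mA : measurable A) (mB : measurable B).
Hypothesis mf : measurable_fun (A `*` B) f.
Hypothesis f0 : forall x, (A `*` B) x -> 0 <= f x.

Let g := f \_ (A `*` B).

Let mg : measurable_fun setT g.
Proof. by apply/(measurable_restrictT _ _).1 => //; exact: measurableX. Qed.

Let g0 x : 0 <= g x.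
Proof. by apply: erestrict_ge0. Qed.

Let g1E t : \int[mu]_s g (t, s) = ((fun t => \int[mu]_(s in B) f (t, s)) \_ A) t.
Proof.
rewrite patchE; case: ifPn => [/set_mem At|/negP nAt].
  rewrite [RHS]integral_mkcond; apply: eq_integral => s _.
  rewrite /g !patchE; congr (if _ then _ else _).
  by apply/idP/idP => /set_mem h; apply/mem_set => //; case: h.
apply: integral0_eq => s _; rewrite /g patchE ifF//.
by apply/negP => /set_mem[/= At _]; apply: nAt; exact/mem_set.
Qed.

Let g2E s : \int[mu]_t g (t, s) = ((fun s => \int[mu]_(t in A) f (t, s)) \_ B) s.
Proof.
rewrite patchE; case: ifPn => [/set_mem Bs|/negP nBs].
  rewrite [RHS]integral_mkcond; apply: eq_integral => t _.
  rewrite /g !patchE; congr (if _ then _ else _).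
  by apply/idP/idP => /set_mem h; apply/mem_set => //; case: h.
apply: integral0_eq => t _; rewrite /g patchE ifF//.
by apply/negP => /set_mem[/= _ Bs]; apply: nBs; exact/mem_set.
Qed.

Lemma setX_integral1 :
  \int[mu2]_(x in A `*` B) f x = \int[mu]_(t in A) \int[mu]_(s in B) f (t, s).
Proof.
rewrite integral_mkcond.
rewrite (fubini_tonelli1 _ mg g0).
rewrite [RHS]integral_mkcond.
by apply: eq_integral => t _; exact: g1E.
Qed.

Lemma setX_integral2 :
  \int[mu2]_(x in A `*` B) f x = \int[mu]_(s in B) \int[mu]_(t in A) f (t, s).
Proof.
rewrite integral_mkcond.
rewrite (fubini_tonelli2 _ mg g0).
rewrite [RHS]integral_mkcond.
by apply: eq_integral => t _; exact: g2E.
Qed.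

Lemma measurable_setX_integral1 :
  measurable_fun A (fun t => \int[mu]_(s in B) f (t, s)).
Proof.
apply/(measurable_restrictT _ mA).
rewrite (_ : _ \_ A = fubini_F mu g); last by apply/funext => t; rewrite -g1E.
exact: measurable_fun_fubini_tonelli_F.
Qed.

Lemma measurable_setX_integral2 :
  measurable_fun B (fun s => \int[mu]_(t in A) f (t, s)).
Proof.
apply/(measurable_restrictT _ mB).
rewrite (_ : _ \_ B = fubini_G mu g); last by apply/funext => t; rewrite -g2E.
exact: measurable_fun_fubini_tonelli_G.
Qed.

End fubini.

(** * Integral bounds for test functions and their limits *)

Section test_function_bounds.
Local Open Scope ereal_scope.

Definition Ioc (a b : R) : set T1 := `]a, b]%classic.

Lemma measurable_Ioc (a b : R) : measurable (Ioc a b).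
Proof. exact: measurable_itv. Qed.

Hint Resolve measurable_Ioc : core.

Lemma mu_Ioc (a b : R) : (a <= b)%R -> mu (Ioc a b) = (b - a)%:E.
Proof.
rewrite lebesgue_measure_itv/= lte_fin le_eqVlt => /predU1P[->|->].
  by rewrite ltxx subrr.
by rewrite EFinB.
Qed.

Lemma le_integral_derive (f g : R -> R) (a b : R) : (a <= b)%R ->
  (forall x : R, is_derive x 1%R f (g x)) -> continuous g ->
  `|f b - f a|%:E <= \int[mu]_(x in Ioc a b) `|g x|%:E.
Proof.
rewrite le_eqVlt => /predU1P[<- _ _|ab df cg].
  by rewrite subrr normr0; apply: integral_ge0 => x _; rewrite lee_fin.
have cf : continuous f by exact: is_derive_continuous df.
have mg : measurable_fun [set: T1] g by exact: continuous_measurable_fun.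
have F : \int[mu]_(x in `[a, b]) (g x)%:E = (f b)%:E - (f a)%:E.
  apply: continuous_FTC2 => //.
  - exact: continuous_subspaceT.
  - split.
    + by move=> x _; exact: (@ex_derive _ _ _ _ _ _ _ (df x)).
    + by apply: cvg_at_right_filter; exact: cf.
    + by apply: cvg_at_left_filter; exact: cf.
  - by move=> x _; rewrite derive1E; exact: (@derive_val _ _ _ _ _ _ _ (df x)).
rewrite -integral_itv_obnd_cbnd in F; last first.
  by apply: measurable_funTS; exact/measurable_EFinP.
rewrite -abse_EFin EFinB -F.
apply: (le_trans (le_abse_integral _ _ _)) => //.
by apply: measurable_funTS; exact/measurable_EFinP.
Qed.

Lemma integral_le_average (A B : set T1) (f p q : T1 -> \bar R) :
  measurable A -> measurable B -> mu A = 1 -> mu B = 1 ->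
  (forall s, B s -> 0 <= f s) -> (forall s, B s -> 0 <= p s) ->
  (forall t, A t -> 0 <= q t) ->
  measurable_fun B p -> measurable_fun A q ->
  (forall s t, B s -> A t -> f s <= p s + q t) ->
  \int[mu]_(s in B) f s <= \int[mu]_(s in B) p s + \int[mu]_(t in A) q t.
Proof.
move=> mA mB muA muB f0 p0 q0 mp mq fpq.
have c1 (C : set T1) x : measurable C -> mu C = 1 -> x = \int[mu]_(s in C) cst x s.
  by move=> mC C1; rewrite integral_cst// -[LHS]mule1 -C1.
have pI : 0 <= \int[mu]_(s in B) p s by exact: integral_ge0.
rewrite [leLHS](c1 A)// [X in _ <= X + _](c1 A)// -ge0_integralD//.
apply: ge0_le_integral_nonmeasurable => t At; first exact: integral_ge0.
rewrite /cst [X in _ <= _ + X](c1 B)// -ge0_integralD//; last first.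
  by move=> s _; exact: q0.
by apply: ge0_le_integral_nonmeasurable => // s Bs; exact: fpq.
Qed.

Variable phi : R * R -> R.
Hypothesis tphi : test_function phi.

Let mphi : measurable_fun [set: T2] phi.
Proof. exact: (continuous_measurable2 _ (test_function_continuous _ tphi)). Qed.

Let mD e : e = @e1 R \/ e = @e2 R -> measurable_fun [set: T2] (fun x => 'D_e phi x).
Proof.
move=> he; apply: continuous_measurable2.
exact: (test_function_continuous_derive _ tphi).
Qed.

Let md1 (s : R) : continuous (fun t => 'D_(@e1 R) phi (t, s)).
Proof.
apply: (continuous_section1 (fun x => 'D_(@e1 R) phi x)).
by apply: (test_function_continuous_derive _ tphi); left.
Qed.

Let md2 (t : R) : continuous (fun s => 'D_(@e2 R) phi (t, s)).
Proof.
apply: (continuous_section2 (fun x => 'D_(@e2 R) phi x)).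
by apply: (test_function_continuous_derive _ tphi); right.
Qed.

(** A test function vanishes at height zero. *)
Lemma test_function_vertical_bound (t s d : R) : (0 < s <= d)%R ->
  `|phi (t, s)|%:E <= \int[mu]_(r in Ioc 0 d) `|'D_(@e2 R) phi (t, r)|%:E.
Proof.
move=> /andP[s0 sd].
have := le_integral_derive (fun r => phi (t, r)) _ _ _ (ltW s0)
  (test_function_is_derive2 _ tphi t) (md2 t).
rewrite (test_function_eq0 _ tphi (t, 0%R))// subr0 => /le_trans; apply.
apply: ge0_subset_integral => //.
- apply: measurable_funTS; apply/measurable_EFinP; apply: measurableT_comp => //.
  exact: continuous_measurable_fun.
- by apply: subset_itvl; rewrite bnd_simp.
Qed.

(** The value at [(t, s)] is compared with the values at the points [(t', s)],
    which are in turn bounded through the vertical segments above [(t', 0)]; then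
    [s] and [t'] are averaged out. *)
Lemma test_function_line_bound (t : R) :
  \int[mu]_(s in Ioc 0 1) `|phi (t, s)|%:E <=
  \int[mu2]_(x in Ioc t (t + 1) `*` Ioc 0 1) `|'D_(@e1 R) phi x|%:E +
  \int[mu2]_(x in Ioc t (t + 1) `*` Ioc 0 1) `|'D_(@e2 R) phi x|%:E.
Proof.
set A := Ioc t (t + 1); set B := Ioc 0 1.
have mA : measurable A by exact: measurable_Ioc.
have mB : measurable B by exact: measurable_Ioc.
have m1 : measurable_fun (A `*` B : set T2) (fun x => `|'D_(@e1 R) phi x|%:E).
  apply: measurable_funTS; apply/measurable_EFinP; apply: measurableT_comp => //.
  by apply: mD; left.
have m2 : measurable_fun (A `*` B : set T2) (fun x => `|'D_(@e2 R) phi x|%:E).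
  apply: measurable_funTS; apply/measurable_EFinP; apply: measurableT_comp => //.
  by apply: mD; right.
rewrite (setX_integral2 _ _ _ mA mB m1 (fun _ _ => normr_ge0 _)).
rewrite (setX_integral1 _ _ _ mA mB m2 (fun _ _ => normr_ge0 _)).
have mi1 := measurable_setX_integral2 A B _ mA mB m1
  (fun _ _ => normr_ge0 _).
have mi2 := measurable_setX_integral1 A B _ mA mB m2
  (fun _ _ => normr_ge0 _).
have muA : mu A = 1 by rewrite mu_Ioc ?lerDl// addrAC subrr add0r.
have muB : mu B = 1 by rewrite mu_Ioc// subr0.
apply: (integral_le_average A B _ _ _ mA mB muA muB _ _ _ mi1 mi2) => //.
- by move=> s _; apply: integral_ge0.
- by move=> t' _; apply: integral_ge0.
move=> s t' Bs At'.
have := Bs; rewrite /B /Ioc/= in_itv/= => sB.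
have := At'; rewrite /A /Ioc/= in_itv/= => /andP[tt' t't].
apply: (@le_trans _ _ (`|phi (t', s) - phi (t, s)|%:E + `|phi (t', s)|%:E)).
  by rewrite -EFinD lee_fin -lerBlDr distrC lerB_dist.
apply: leeD; last exact: test_function_vertical_bound.
apply: (le_trans (le_integral_derive (fun r => phi (r, s)) _ _ _ (ltW tt')
  (fun r => test_function_is_derive1 _ tphi r s) (md1 s))).
apply: ge0_subset_integral => //.
- apply: measurable_funTS; apply/measurable_EFinP; apply: measurableT_comp => //.
  exact: continuous_measurable_fun.
- by apply: subset_itvl; rewrite bnd_simp.
Qed.

Lemma test_function_box_bound (a b c d : R) : (0 < c)%R -> (c <= d)%R ->
  \int[mu2]_(x in box a b c d) `|phi x|%:E <=
  (d - c)%:E *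
  \int[mu2]_(x in `[a, b]%classic `*` Ioc 0 d) `|'D_(@e2 R) phi x|%:E.
Proof.
move=> c0 cd; rewrite boxE.
have m2 : measurable_fun [set: T2] (fun x => `|'D_(@e2 R) phi x|%:E).
  by apply/measurable_EFinP; apply: measurableT_comp => //; apply: mD; right.
rewrite setX_integral1//; last first.
  by apply: measurable_funTS; apply/measurable_EFinP; exact: measurableT_comp.
rewrite setX_integral1//; last exact: measurable_funTS.
rewrite -ge0_integralZl//; last 3 first.
- exact: (measurable_setX_integral1 _ _ _ (measurable_itv _) (measurable_Ioc _ _)
    (measurable_funTS m2) (fun _ _ => normr_ge0 _)).
- by move=> t _; apply: integral_ge0.
- by rewrite lee_fin subr_ge0.
apply: ge0_le_integral_nonmeasurable => t At; first by apply: integral_ge0.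
have -> : (d - c)%:E = mu `[c, d].
  rewrite lebesgue_measure_itv/= lte_fin; move: cd; rewrite le_eqVlt.
  by case: ltP => [//|dc] /orP[/eqP->|//]; rewrite subrr.
rewrite muleC -integral_cst//; apply: ge0_le_integral_nonmeasurable => // s /=.
rewrite in_itv/= => /andP[cs sd]; apply: test_function_vertical_bound.
by rewrite sd (lt_le_trans c0).
Qed.

End test_function_bounds.

Section limits_of_test_functions.
Local Open Scope ereal_scope.
Implicit Types (u : R * R -> R) (G : R).

(** What the proof retains of the completion: on every box [u] is close in mean
    to a test function whose gradient is bounded, in mean over sets of finite
    measure, as if its norm were at most [G]. *)
Definition approximable u G : Prop :=
  measurable_fun (@half_plane R : set T2) u /\
  forall (a b c d eps : R), (0 < c)%R -> (0 < eps)%R ->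
  exists phi : R * R -> R, [/\ test_function phi,
    \int[mu2]_(x in box a b c d) `|u x - phi x|%:E <= eps%:E &
    forall e, e = @e1 R \/ e = @e2 R -> forall (D : set T2) (B : R),
      measurable D -> D `<=` @half_plane R -> (0 < B)%R ->
      mu2 D <= (B ^+ 2)%:E ->
      \int[mu2]_(x in D) `|'D_e phi x|%:E <= (B * (G + eps))%:E].

Lemma cvg0_near_le (f : nat -> \bar R) (eps : R) :
  f k @[k --> \oo] --> 0 -> (0 < eps)%R -> \forall k \near \oo, f k <= eps%:E.
Proof.
move=> f0 e0; apply: (f0 [set y | y <= eps%:E]).
change (\forall r \near (0%R : R), r%:E <= eps%:E).
by near=> r; rewrite /= lee_fin; apply: ltW; near: r; exact: lt_nbhsl.
Unshelve. all: by end_near. Qed.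

Lemma poweR_half_le (x : \bar R) (y : R) : 0 <= x -> (0 <= y)%R ->
  x `^ 2^-1 <= y%:E -> x <= (y ^+ 2)%:E.
Proof.
move=> x0 y0 xy; rewrite -[leLHS]poweRe1// -(@mulVf _ 2%R)// poweRrM.
rewrite -powR_mulrn// -poweR_EFin.
by apply: gt0_ler_poweR => //; rewrite in_itv/= leey andbT ?poweR_ge0 ?lee_fin.
Qed.

Lemma mu_itv_le (a b : R) : mu `[a, b] <= `|b - a|%:E.
Proof.
by rewrite lebesgue_measure_itv/= lte_fin; case: ifP => _; rewrite -?EFinB lee_fin ?ler_norm.
Qed.

Lemma mu2_box_le (a b c d : R) : mu2 (box a b c d) <= (`|b - a| * `|d - c|)%:E.
Proof.
rewrite boxE product_measure1E//; try exact: measurable_itv.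
by rewrite EFinM lee_pmul// mu_itv_le.
Qed.

Lemma approximable_limit u G (phi_ : nat -> R * R -> R) :
  Hdot1 u -> (0 < G)%R -> grad_L2norm u <= G%:E ->
  (forall k, test_function (phi_ k)) ->
  grad_L2_cvg phi_ u -> L2loc_cvg phi_ u -> approximable u G.
Proof.
move=> [lu [_ l1 _] [_ l2 _] _] G0 uG tphi gphi lphi.
have measu := L1loc_measurable _ lu.
have m1 := L1loc_measurable _ l1; have m2 := L1loc_measurable _ l2.
split=> [//|a b c d eps c0 e0].
have HG : \int[mu2]_(x in @half_plane R)
    (weak_derivative (@e1 R) u x ^+ 2 + weak_derivative (@e2 R) u x ^+ 2)%:E
    <= (G ^+ 2)%:E.
  apply: (poweR_half_le _ _ _ (ltW G0) uG).
  by apply: integral_ge0 => x _; rewrite lee_fin addr_ge0// sqr_ge0.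
have sqr_leDl (y z : R) : (y ^+ 2 <= y ^+ 2 + z ^+ 2)%R by rewrite lerDl sqr_ge0.
have sqr_leDr (y z : R) : (z ^+ 2 <= y ^+ 2 + z ^+ 2)%R by rewrite lerDr sqr_ge0.
have [B B0 hB] : exists2 B : R, (0 < B)%R & mu2 (box a b c d) <= (B ^+ 2)%:E.
  exists (1 + `|b - a| * `|d - c|)%R; first by rewrite ltr_pwDl// mulr_ge0.
  apply: (le_trans (mu2_box_le _ _ _ _)); rewrite lee_fin.
  have : (0 <= `|b - a| * `|d - c|)%R by rewrite mulr_ge0.
  by move: (_ * _)%R => y y0; nra.
have HGe e : e = @e1 R \/ e = @e2 R -> \int[mu2]_(x in @half_plane R)
    (weak_derivative e u x ^+ 2)%:E <= (G ^+ 2)%:E.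
  move=> he; apply: le_trans HG; apply: ge0_le_integral_nonmeasurable => x _.
    by rewrite lee_fin sqr_ge0.
  rewrite lee_fin.
  by case: he => ->; [exact: sqr_leDl|exact: sqr_leDr].
have mw e : e = @e1 R \/ e = @e2 R ->
    measurable_fun (@half_plane R : set T2) (weak_derivative e u).
  by case=> ->; [exact: m1|exact: m2].
have k1 := gphi (@e1 R) (or_introl erefl).
have k2 := gphi (@e2 R) (or_intror erefl).
have k3 := lphi _ (compact_box a b c d) (@box_half_plane _ _ _ _ _ c0).
have ee : (0 < eps ^+ 2)%R by rewrite exprn_gt0.
have eB : (0 < (eps / B) ^+ 2)%R by rewrite exprn_gt0// divr_gt0.
have [k [n1 [n2 n3]]] := filter_ex (filterI (cvg0_near_le _ _ k1 ee)
  (filterI (cvg0_near_le _ _ k2 ee) (cvg0_near_le _ _ k3 eB))).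
have n12 e : e = @e1 R \/ e = @e2 R -> L2normsq (@half_plane R)
    (fun x => 'D_e (phi_ k) x - weak_derivative e u x)%R <= (eps ^+ 2)%:E.
  by case=> ->; [exact: n1|exact: n2].
move=> {n1 n2}.
have mphi : measurable_fun [set: T2] (phi_ k).
  exact: (continuous_measurable2 _ (test_function_continuous _ (tphi k))).
exists (phi_ k); split => //.
  under eq_integral do rewrite distrC.
  apply: (@le_trans _ _ ((eps / B) * B)%:E); last by rewrite divfK ?gt_eqF.
  apply: integral_cauchy_schwarz => //; [exact: measurable_box| |exact: divr_gt0].
  apply: measurable_funB; first exact: measurable_funTS.
  by apply: measurable_funS measu; [exact: measurable_half_plane|exact: box_half_plane].
move=> e he D C mD DH C0 hC.
have mDe : measurable_fun D (fun x => 'D_e (phi_ k) x).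
  apply: measurable_funTS; apply: continuous_measurable2.
  exact: (test_function_continuous_derive _ (tphi k)).
have mwD : measurable_fun D (weak_derivative e u).
  by apply: measurable_funS (mw e he) => //; exact: measurable_half_plane.
rewrite mulrC mulrDl EFinD.
apply: (@le_trans _ _ (\int[mu2]_(x in D) (`|weak_derivative e u x|%:E +
    `|'D_e (phi_ k) x - weak_derivative e u x|%:E))).
  apply: ge0_le_integral_nonmeasurable => // x _.
  by rewrite -EFinD lee_fin -lerBlDl lerB_dist.
rewrite ge0_integralD//; last 2 first.
- by apply/measurable_EFinP; exact: measurableT_comp.
- by apply/measurable_EFinP; apply: measurableT_comp => //; exact: measurable_funB.
apply: leeD.
  apply: integral_cauchy_schwarz => //; apply: le_trans (HGe e he).
  apply: ge0_subset_integral => //; first exact: measurable_half_plane.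
    by apply/measurable_EFinP; apply: measurable_funX; exact: mw.
  by move=> x _; rewrite lee_fin sqr_ge0.
apply: integral_cauchy_schwarz => //; first exact: measurable_funB.
apply: (@le_trans _ _ (L2normsq (@half_plane R)
    (fun x => 'D_e (phi_ k) x - weak_derivative e u x)%R)).
  apply: ge0_subset_integral => //; first exact: measurable_half_plane.
    apply/measurable_EFinP; apply: measurable_funX; apply: measurable_funB.
      apply: measurable_funTS; apply: continuous_measurable2.
      exact: (test_function_continuous_derive _ (tphi k)).
    exact: mw.
  by move=> x _; rewrite lee_fin sqr_ge0.
exact: n12.
Qed.

(** Neither the support nor the height [C] of the weight [al] enters the bound,
    so that the weight may be concentrated at a point: this is the bound on
    vertical lines in averaged form. *)
Lemma approximable_line_bound u G (al : R -> R) (a b c C : R) :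
  approximable u G -> (0 < c <= 1)%R -> measurable_fun [set: T1] al ->
  (forall t, 0 <= al t <= C)%R -> \int[mu]_(t in `[a, b]) (al t)%:E <= 1 ->
  \int[mu2]_(x in box a b c 1) (`|u x| * al x.1)%:E <= (2 * G)%:E.
Proof.
move=> [measu hu] /andP[c0 c1] mal alC alI.
have al0 t : (0 <= al t)%R by have /andP[] := alC t.
have C0 : (0 <= C)%R by have /andP[/le_trans] := alC 0%R; apply.
have mbox := measurable_box a b c 1.
have mub : measurable_fun (box a b c 1 : set T2) u.
  by apply: measurable_funS measu; [exact: measurable_half_plane|exact: box_half_plane].
have mal2 : measurable_fun [set: T2] (fun x => al x.1) by exact: measurableT_comp.
apply/lee_addgt0Pr => eps e0.
(* An error [del] in mean costs [C * del] through the weight and [2 * del]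
   through the gradient of the approximation. *)
have D0 : (0 < C + 2)%R by rewrite ltr_wpDl.
have [phi [tphi uphi dphi]] := hu a b c 1%R (eps / (C + 2))%R c0 (divr_gt0 e0 D0).
have mphi : measurable_fun [set: T2] phi.
  exact: (continuous_measurable2 _ (test_function_continuous _ tphi)).
set del := (eps / (C + 2))%R in uphi dphi.
have line t : \int[mu]_(s in Ioc 0 1) `|phi (t, s)|%:E <= (2 * (G + del))%:E.
  have mu1 : mu2 (Ioc t (t + 1) `*` Ioc 0 1) <= (1 ^+ 2)%:E.
    rewrite product_measure1E; try exact: measurable_Ioc.
    rewrite [X in X * _]mu_Ioc ?lerDl// [X in _ * X]mu_Ioc//.
    by rewrite subr0 addrAC subrr add0r mule1 expr1n.
  have sub : Ioc t (t + 1) `*` Ioc 0 1 `<=` @half_plane R.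
    by move=> x [_]; rewrite /Ioc/= in_itv/= => /andP[].
  have mD : measurable (Ioc t (t + 1) `*` Ioc 0 1 : set T2).
    by apply: measurableX; exact: measurable_Ioc.
  apply: (le_trans (test_function_line_bound _ tphi t)).
  rewrite (_ : (2 * (G + del) = 1 * (G + del) + 1 * (G + del))%R); last by ring.
  rewrite EFinD; apply: leeD.
    by apply: dphi => //; left.
  by apply: dphi => //; right.
apply: (@le_trans _ _ (\int[mu2]_(x in box a b c 1)
   (C%:E * `|u x - phi x|%:E + (`|phi x| * al x.1)%:E))).
  apply: ge0_le_integral_nonmeasurable => x _.
    by rewrite lee_fin mulr_ge0.
  rewrite -EFinM -EFinD lee_fin.
  have /andP[? ?] := alC x.1.
  apply: (@le_trans _ _ (`|u x - phi x| * al x.1 + `|phi x| * al x.1)%R).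
    by rewrite -mulrDl ler_wpM2r// -lerBlDr lerB_dist.
  by rewrite lerD2r mulrC ler_wpM2r.
have m1 : measurable_fun (box a b c 1 : set T2) (fun x => `|u x - phi x|%:E).
  apply/measurable_EFinP; apply: measurableT_comp => //; apply: measurable_funB => //.
  exact: measurable_funTS.
have m2 : measurable_fun (box a b c 1 : set T2) (fun x => (`|phi x| * al x.1)%:E).
  apply/measurable_EFinP; apply: measurable_funM; last exact: measurable_funTS.
  by apply: measurable_funTS; exact: measurableT_comp.
have i1 : 0 <= \int[mu2]_(x in box a b c 1) `|u x - phi x|%:E.
  by apply: integral_ge0 => x _; rewrite lee_fin.
rewrite ge0_integralD//; last 3 first.
- by move=> x _; rewrite mule_ge0// lee_fin.
- exact: emeasurable_funM.
- by move=> x _; rewrite lee_fin mulr_ge0.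
rewrite ge0_integralZl//.
have -> : (2 * G)%:E + eps%:E = (C * del)%:E + (2 * (G + del))%:E.
  by rewrite -!EFinD; congr EFin; rewrite /del; field; rewrite gt_eqF.
apply: leeD; first by rewrite EFinM lee_pmul.
rewrite boxE in m2 *.
rewrite (setX_integral1 _ _ _ (measurable_itv _) (measurable_itv _) m2); last first.
  by move=> x _; rewrite lee_fin mulr_ge0.
have K0 : 0 <= (2 * (G + del))%:E.
  by apply: le_trans (line 0%R); apply: integral_ge0 => s _; rewrite lee_fin.
apply: (@le_trans _ _ (\int[mu]_(t in `[a, b]) ((2 * (G + del))%:E * (al t)%:E))).
  apply: ge0_le_integral_nonmeasurable => t _.
    by apply: integral_ge0 => s _; rewrite lee_fin mulr_ge0.
  have mphit : measurable_fun [set: T1] (fun s => phi (t, s)).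
    apply: continuous_measurable_fun; apply: continuous_section2.
    exact: test_function_continuous.
  have mphit2 : measurable_fun [set: T1] (fun s => `|phi (t, s)|%:E).
    by apply/measurable_EFinP; exact: measurableT_comp.
  under eq_integral do rewrite EFinM/=.
  rewrite ge0_integralZr//; last 2 first.
  - exact: measurable_funTS.
  - by rewrite lee_fin.
  apply: lee_wpmul2r; first by rewrite lee_fin.
  apply: le_trans (line t); apply: ge0_subset_integral => //.
  - exact: measurable_Ioc.
  - exact: measurable_funTS.
  - by move=> s; rewrite /Ioc/= !in_itv/= => /andP[cs ->]; rewrite (lt_le_trans c0 cs).
rewrite ge0_integralZl//; last 2 first.
- by apply: measurable_funTS; exact/measurable_EFinP.
- by move=> t _; rewrite lee_fin.
by rewrite -[leRHS]mule1 lee_wpmul2l.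
Qed.

(** The approximating functions vanish at height zero, so their values at the
    heights in [[c, d]] are bounded by integrals of the gradient over vertical
    segments; the factor [d - c] comes from the integration over these heights. *)
Lemma approximable_box_bound u G (a b c d B : R) :
  approximable u G -> (0 < c <= d)%R -> (a <= b)%R -> (0 < B)%R ->
  ((b - a) * d <= B ^+ 2)%R ->
  \int[mu2]_(x in box a b c d) `|u x|%:E <= ((d - c) * (B * G))%:E.
Proof.
move=> [measu hu] /andP[c0 cd] ab B0 hB.
have mbox := measurable_box a b c d.
have mub : measurable_fun (box a b c d : set T2) u.
  by apply: measurable_funS measu; [exact: measurable_half_plane|exact: box_half_plane].
have dc0 : (0 <= d - c)%R by rewrite subr_ge0.
have d0 : (0 <= d)%R by rewrite (le_trans _ cd)// ltW.
apply/lee_addgt0Pr => eps e0.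
have D0 : (0 < (d - c) * B + 1)%R by rewrite ltr_wpDl// mulr_ge0// ltW.
have [phi [tphi uphi dphi]] := hu a b c d _ c0 (divr_gt0 e0 D0).
have mphi : measurable_fun [set: T2] phi.
  exact: (continuous_measurable2 _ (test_function_continuous _ tphi)).
set del := (eps / ((d - c) * B + 1))%R in uphi dphi.
apply: (@le_trans _ _ (\int[mu2]_(x in box a b c d)
   (`|u x - phi x|%:E + `|phi x|%:E))).
  apply: ge0_le_integral_nonmeasurable => x _; first by rewrite lee_fin.
  by rewrite -EFinD lee_fin -lerBlDr lerB_dist.
rewrite ge0_integralD//; last 2 first.
- apply/measurable_EFinP; apply: measurableT_comp => //; apply: measurable_funB => //.
  exact: measurable_funTS.
- by apply/measurable_EFinP; apply: measurable_funTS; exact: measurableT_comp.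
have -> : ((d - c) * (B * G))%:E + eps%:E = del%:E + ((d - c) * (B * (G + del)))%:E.
  by rewrite -!EFinD; congr EFin; rewrite /del; field; rewrite gt_eqF.
apply: leeD => //.
apply: (le_trans (test_function_box_bound _ tphi a b c d c0 cd)).
rewrite EFinM lee_wpmul2l ?lee_fin//; apply: dphi => //; first by right.
- by apply: measurableX => //; exact: measurable_Ioc.
- by move=> x [_]; rewrite /Ioc/= in_itv/= => /andP[].
rewrite product_measure1E//; last exact: measurable_Ioc.
rewrite [X in _ * X]mu_Ioc// subr0.
apply: (@le_trans _ _ ((b - a)%:E * d%:E)); last by rewrite -EFinM lee_fin.
apply: lee_wpmul2r; first by rewrite lee_fin.
by apply: (le_trans (mu_itv_le _ _)); rewrite ger0_norm ?subr_ge0.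
Qed.

End limits_of_test_functions.

(** * The weighted norm away from the boundary *)

Section tail.
Local Open Scope ereal_scope.

Lemma measurable_slice (u : R * R -> R) (s : R) :
  measurable_fun (@half_plane R : set T2) u -> (0 < s)%R ->
  measurable_fun [set: T1] (fun t => u (t, s)).
Proof.
move=> measu s0.
have mr : measurable_fun [set: T2] (u \_ (@half_plane R)).
  by apply/(measurable_restrictT _ _).1 => //; exact: measurable_half_plane.
rewrite (_ : (fun t => _) = (u \_ (@half_plane R)) \o (fun t : T1 => (t, s))).
  by apply: measurableT_comp => //; exact: measurable_pair2.
by apply/funext => t /=; rewrite patchE mem_set.
Qed.

Lemma slice_Linfty_ge0 (u : R * R -> R) (s : R) : 0 <= slice_Linfty u s.
Proof. exact: Lnorm_ge0. Qed.

(** Averaging replaces the essential supremum by an integral, which depends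
    measurably on the height. *)
Lemma average_le_slice_Linfty (u : R * R -> R) (al : R -> R) (a b s : R) :
  measurable_fun [set: T1] (fun t => u (t, s)) -> measurable_fun [set: T1] al ->
  (forall t, 0 <= al t)%R -> \int[mu]_(t in `[a, b]) (al t)%:E <= 1 ->
  \int[mu]_(t in `[a, b]) (`|u (t, s)| * al t)%:E <= slice_Linfty u s.
Proof.
move=> mus mal al0 alI.
have M0 := slice_Linfty_ge0 u s.
have : {ae mu, forall t, `|u (t, s)|%:E <= slice_Linfty u s}.
  have muT : 0 < mu [set: T1].
    apply: (@lt_le_trans _ _ (mu (Ioc 0 1))); first by rewrite mu_Ioc// subr0 lte01.
    by apply: le_measure => //; rewrite inE//; exact: measurable_Ioc.
  rewrite /slice_Linfty unlock /Lnorm muT.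
  exact: (ess_sup_inf.ess_sup_ge mu (fun t => `|(u (t, s))%:E|)).
case: (slice_Linfty u s) M0 => [r|_ _|//]; last exact: leey.
rewrite lee_fin => r0 aer.
apply: (@le_trans _ _ (\int[mu]_(t in `[a, b]) (r%:E * (al t)%:E))); last first.
  rewrite ge0_integralZl//; last 2 first.
  - by apply: measurable_funTS; exact/measurable_EFinP.
  - by move=> t _; rewrite lee_fin.
  by rewrite -[leRHS]mule1 lee_wpmul2l.
apply: ae_ge0_le_integral => //.
- by move=> t _; rewrite lee_fin mulr_ge0.
- apply/measurable_EFinP; apply: measurable_funM; last exact: measurable_funTS.
  by apply: measurable_funTS; exact: measurableT_comp.
- by move=> t _; rewrite -EFinM lee_fin mulr_ge0.
- by apply: emeasurable_funM => //; apply/measurable_EFinP; exact: measurable_funTS.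
case: aer => N [mN N0 hN]; exists N; split => //; apply: subset_trans hN => t.
by apply: contra_not => /= h _; rewrite EFinM lee_wpmul2r// lee_fin.
Qed.

Lemma continuous_inv_itv (d : R) :
  {within `[1%R, d], continuous (fun s : R => s^-1)%R}.
Proof.
apply: continuous_in_subspaceT => x; rewrite inE/= in_itv/= => /andP[x1 _].
by apply: inv_continuous; rewrite gt_eqF// (lt_le_trans _ x1).
Qed.

Lemma measurable_inv_Ioc (d : R) : measurable_fun (Ioc 1 d) (fun s => s^-1)%R.
Proof.
apply: (@measurable_funS _ _ _ _ `[1%R, d]%classic) => //.
  by apply: subset_itvr; rewrite bnd_simp.
apply: subspace_continuous_measurable_fun => //; exact: continuous_inv_itv.
Qed.

Lemma integral_inv (d : R) : (1 < d)%R ->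
  \int[mu]_(s in Ioc 1 d) (s^-1)%:E = (ln d)%:E.
Proof.
move=> d1; have cwi := continuous_inv_itv d.
have F : \int[mu]_(s in `[1%R, d]) (s^-1)%:E = (ln d)%:E - (ln 1)%:E.
  apply: continuous_FTC2 => //.
  - split.
    + move=> x; rewrite in_itv/= => /andP[x1 _].
      exact: (@ex_derive _ _ _ _ _ _ _ (is_derive1_ln (lt_trans ltr01 x1))).
    + by apply: cvg_at_right_filter; apply: continuous_ln.
    + by apply: cvg_at_left_filter; apply: continuous_ln; rewrite (lt_trans _ d1).
  - move=> x; rewrite in_itv/= => /andP[x1 _]; rewrite derive1E.
    exact: (@derive_val _ _ _ _ _ _ _ (is_derive1_ln (lt_trans ltr01 x1))).
move: F; rewrite ln1 sube0 => <-.
rewrite /Ioc integral_itv_obnd_cbnd//; apply/measurable_EFinP.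
exact: measurable_inv_Ioc.
Qed.

(** Cauchy-Schwarz in the vertical variable for the weights [s] and [s^-1]. *)
Lemma tail_bound (u : R * R -> R) (al : R -> R) (a b d A : R) :
  measurable_fun (@half_plane R : set T2) u -> measurable_fun [set: T1] al ->
  (forall t, 0 <= al t)%R -> \int[mu]_(t in `[a, b]) (al t)%:E <= 1 ->
  (1 < d)%R -> (0 < A)%R -> Xnormsq u <= (A ^+ 2)%:E ->
  \int[mu2]_(x in `[a, b]%classic `*` Ioc 1 d) (`|u x| * al x.1)%:E <=
  (A * Num.sqrt (ln d))%:E.
Proof.
move=> measu mal al0 alI d1 A0 uA.
have l0 : (0 < ln d)%R by rewrite ln_gt0.
set B := Num.sqrt (ln d); have B0 : (0 < B)%R by rewrite sqrtr_gt0.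
have B2 : (B ^+ 2 = ln d)%R by rewrite sqr_sqrtr// ltW.
have mI := @measurable_itv R `[a, b]; have mJ := measurable_Ioc 1 d.
have mf : measurable_fun (`[a, b]%classic `*` Ioc 1 d : set T2)
    (fun x => (`|u x| * al x.1)%:E).
  apply/measurable_EFinP; apply: measurable_funM.
    apply: measurableT_comp => //; apply: measurable_funS measu.
      exact: measurable_half_plane.
    by move=> x [_]; rewrite /Ioc/= in_itv/= => /andP[/(lt_trans ltr01)].
  by apply: measurable_funTS; exact: measurableT_comp.
have f0 x : (`[a, b]%classic `*` Ioc 1 d) x -> 0 <= (`|u x| * al x.1)%:E.
  by move=> _; rewrite lee_fin mulr_ge0.
rewrite (setX_integral2 _ _ _ mI mJ mf f0).
have mm := measurable_setX_integral2 _ _ _ mI mJ mf f0.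
set m := (fun s => \int[mu]_(t in _) _) in mm.
have m0 s : 0 <= m s by apply: integral_ge0 => t _; rewrite lee_fin mulr_ge0.
have mM s : Ioc 1 d s -> m s <= slice_Linfty u s.
  rewrite /Ioc/= in_itv/= => /andP[s1 _]; apply: average_le_slice_Linfty => //.
  by apply: measurable_slice => //; rewrite (lt_trans _ s1).
have ms : \int[mu]_(s in Ioc 1 d) (s%:E * m s ^+ 2) <= (A ^+ 2)%:E.
  apply: le_trans uA; rewrite /Xnormsq.
  rewrite [leLHS]integral_mkcond [leRHS]integral_mkcond.
  apply: ge0_le_integral_nonmeasurable => s _.
    apply: erestrict_ge0 => {}s; rewrite /Ioc/= in_itv/= => /andP[s1 _].
    by rewrite mule_ge0 ?lee_fin ?(ltW (lt_trans ltr01 s1))// mule_ge0.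
  rewrite [leLHS]patchE; case: ifPn => [/set_mem sJ|_].
    have := sJ; rewrite /Ioc/= in_itv/= => /andP[s1 _].
    have s0 := lt_trans ltr01 s1.
    rewrite patchE ifT; last by apply/mem_set; rewrite /= in_itv/= s0.
    apply: lee_wpmul2l; first by rewrite lee_fin ltW.
    by rewrite lee_pmul// mM.
  apply: erestrict_ge0 => {}s; rewrite /= in_itv/= andbT => s0.
  by apply: mule_ge0; [rewrite lee_fin ltW|apply: mule_ge0; exact: slice_Linfty_ge0].
apply: (@le_trans _ _ (\int[mu]_(s in Ioc 1 d)
    ((A / B / 2)%:E * (s^-1)%:E + (B / A / 2)%:E * (s%:E * m s ^+ 2)))).
  apply: ge0_le_integral_nonmeasurable => s; first by move=> _; exact: m0.
  rewrite /Ioc/= in_itv/= => /andP[s1 _].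
  have s0 := lt_trans ltr01 s1; rewrite -/(m s).
  have := m0 s; case: (m s) => [y y0|_|//].
    (* The weights [A / B / 2] and [B / A / 2] make the two integrals at most
       [A * B / 2] each. *)
    rewrite -!EFinM -EFinD lee_fin -subr_ge0.
    rewrite (_ : (_ - _ = (A - B * s * y) ^+ 2 / (A * B * s * 2))%R).
      by rewrite divr_ge0 ?sqr_ge0// !mulr_ge0// ltW.
    by field; rewrite !gt_eqF.
  rewrite mulyy gt0_muley ?lte_fin// gt0_muley ?addey// lte_fin.
  by rewrite !divr_gt0.
have p1 : (0 <= A / B / 2)%R by rewrite !divr_ge0// ltW.
have p2 : (0 <= B / A / 2)%R by rewrite !divr_ge0// ltW.
have mi : measurable_fun (Ioc 1 d) (fun s => (s^-1)%:E).
  by apply/measurable_EFinP; exact: measurable_inv_Ioc.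
have msm : measurable_fun (Ioc 1 d) (fun s => s%:E * m s ^+ 2).
  apply: emeasurable_funM.
    by apply: measurable_funTS; exact/measurable_EFinP.
  exact: emeasurable_funM.
have q1 s : Ioc 1 d s -> 0 <= (s^-1)%:E.
  by rewrite /Ioc/= in_itv/= lee_fin invr_ge0 => /andP[/(lt_trans ltr01)/ltW].
have q2 s : Ioc 1 d s -> 0 <= s%:E * m s ^+ 2.
  rewrite /Ioc/= in_itv/= => /andP[/(lt_trans ltr01)/ltW s0 _].
  by rewrite mule_ge0// mule_ge0.
rewrite ge0_integralD//; last 4 first.
- by move=> s /q1 h; rewrite mule_ge0.
- exact: emeasurable_funM.
- by move=> s /q2 h; rewrite mule_ge0.
- exact: emeasurable_funM.
rewrite ge0_integralZl// ge0_integralZl// integral_inv// -B2.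
have -> : (A * B)%:E = (A / B / 2 * B ^+ 2)%:E + (B / A / 2 * A ^+ 2)%:E.
  by rewrite -EFinD; congr EFin; field; rewrite !gt_eqF.
rewrite [in leRHS]EFinM [X in _ <= _ + X]EFinM leeD2l//.
by apply: lee_wpmul2l; rewrite ?lee_fin.
Qed.

End tail.

(** * Averaging kernels *)

Section kernels.

Definition averaging_kernel (w : R -> R) (a b C : R) : Prop :=
  [/\ smooth1 w, (forall t, 0 <= w t <= C),
      (forall t, ~~ (a <= t <= b) -> w t = 0) &
      (\int[mu]_(t in `[a, b]) (w t)%:E = 1)%E].

(** The supports of [rkernel e y] and [lkernel e y] lie at distance at least [e]
    from [y], on its right and on its left: at [y = 0] the former is thus
    supported inside the open half-line. *)
Definition rkernel (e y t : R) : R := dstep ((t - y) / e) / e.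

Definition lkernel (e y t : R) : R := dstep ((y - t) / e) / e.

Lemma is_derive_step_affine (a b t : R) :
  is_derive t 1 (fun t => step (a * t + b)) (dstep (a * t + b) * a).
Proof.
have dab : is_derive t 1 (fun t => a * t + b) a.
  by apply: is_derive_eq; rewrite addr0 /GRing.scale/= mulr1.
exact: (is_derive1_comp (is_derive_step _) dab).
Qed.

Lemma integral_dstep (c k l a b : R) : a < b ->
  (\int[mu]_(t in `[a, b]) (c * (dstep (k * t + l) * k))%:E =
  (c * step (k * b + l) - c * step (k * a + l))%:E)%E.
Proof.
move=> ab.
have dF (t : R) : is_derive t 1 (fun t => c * step (k * t + l))
    (c * (dstep (k * t + l) * k)).
  exact: (is_deriveZ c (is_derive_step_affine k l t)).
have cf : continuous (fun t : R => c * (dstep (k * t + l) * k)).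
  apply: smooth1_continuous.
  apply: (smooth1M (cst c) (fun t => dstep (k * t + l) * k)); first exact: smooth1_cst.
  apply: (smooth1M (fun t => dstep (k * t + l)) (cst k)); last exact: smooth1_cst.
  exact/smooth1_affine/smooth1_dstep.
have cF : continuous (fun t => c * step (k * t + l)) := is_derive_continuous _ _ dF.
rewrite EFinB; apply: (continuous_FTC2 (F := fun t => c * step (k * t + l)) ab).
- exact: continuous_subspaceT.
- split.
  + by move=> x _; exact: (@ex_derive _ _ _ _ _ _ _ (dF x)).
  + by apply: cvg_at_right_filter; exact: cF.
  + by apply: cvg_at_left_filter; exact: cF.
- by move=> x _; rewrite derive1E; exact: (@derive_val _ _ _ _ _ _ _ (dF x)).
Qed.

Lemma rkernelE (e y t : R) :
  rkernel e y t = 1 * (dstep (e^-1 * t + (- y / e)) * e^-1).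
Proof. by rewrite /rkernel mulrDl mulNr (mulrC t) mul1r. Qed.

Lemma lkernelE (e y t : R) :
  lkernel e y t = -1 * (dstep (- e^-1 * t + y / e) * (- e^-1)).
Proof.
by rewrite /lkernel mulrBl mulrN mulN1r opprK (addrC (y / e)) (mulNr _ t) (mulrC t).
Qed.

Lemma smooth1_rkernel e y : smooth1 (rkernel e y).
Proof.
rewrite (_ : rkernel e y = fun t => dstep (e^-1 * t + (- y / e)) * cst e^-1 t).
  apply: (smooth1M (fun t => dstep _) (cst e^-1)); last exact: smooth1_cst.
  exact/smooth1_affine/smooth1_dstep.
by apply/funext => t; rewrite rkernelE mul1r.
Qed.

Lemma smooth1_lkernel e y : smooth1 (lkernel e y).
Proof.
rewrite (_ : lkernel e y = fun t => dstep (- e^-1 * t + y / e) * cst e^-1 t).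
  apply: (smooth1M (fun t => dstep _) (cst e^-1)); last exact: smooth1_cst.
  exact/smooth1_affine/smooth1_dstep.
by apply/funext => t; rewrite lkernelE mulrN mulN1r opprK.
Qed.

Lemma kernel_rkernel (C e y : R) : (forall t, dstep t <= C) -> 0 < e ->
  averaging_kernel (rkernel e y) (y + e) (y + 2 * e) (C / e).
Proof.
move=> hC e0; split; first exact: smooth1_rkernel.
- by move=> t; rewrite /rkernel divr_ge0 ?dstep_ge0 ?(ltW e0)//= ler_pM2r ?invr_gt0.
- move=> t h; rewrite /rkernel dstep_eq0 ?mul0r//; apply: contra h.
  by rewrite ler_pdivlMr// ler_pdivrMr// => /andP[? ?]; apply/andP; split; lra.
- under eq_integral do rewrite rkernelE.
  rewrite integral_dstep; last lra.
  rewrite step_eq1; last first.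
    rewrite (_ : _ + _ = 2)//; field; exact: lt0r_neq0.
  rewrite step_eq0 ?mulr0 ?subr0 ?mulr1//.
  rewrite (_ : _ + _ = 1)//; field; exact: lt0r_neq0.
Qed.

Lemma kernel_lkernel (C e y : R) : (forall t, dstep t <= C) -> 0 < e ->
  averaging_kernel (lkernel e y) (y - 2 * e) (y - e) (C / e).
Proof.
move=> hC e0; split; first exact: smooth1_lkernel.
- by move=> t; rewrite /lkernel divr_ge0 ?dstep_ge0 ?(ltW e0)//= ler_pM2r ?invr_gt0.
- move=> t h; rewrite /lkernel dstep_eq0 ?mul0r//; apply: contra h.
  by rewrite ler_pdivlMr// ler_pdivrMr// => /andP[? ?]; apply/andP; split; lra.
- under eq_integral do rewrite lkernelE.
  rewrite integral_dstep; last lra.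
  rewrite step_eq0; last first.
    by rewrite (_ : _ + _ = 1)//; field; exact: lt0r_neq0.
  rewrite step_eq1 ?mulr0 ?sub0r ?mulr1 ?opprK//.
  by rewrite (_ : _ + _ = 2)//; field; exact: lt0r_neq0.
Qed.

(** A cut-off whose derivative is a difference of two averaging kernels, one
    near each end: under the integral it produces an increment. *)
Definition plateau (e a b t : R) : R := step ((t - a) / e) + step ((b - t) / e) - 1.

Section plateau.
Variables (e a b : R).
Hypotheses (e0 : 0 < e) (eab : 4 * e <= b - a).

Lemma plateauE (t : R) :
  plateau e a b t = step (e^-1 * t + (- a / e)) + step (- e^-1 * t + b / e) + cst (-1) t.
Proof.
rewrite /plateau; congr (step _ + step _ + _); first by rewrite mulrDl mulNr mulrC.
by rewrite mulrBl addrC mulNr [t / e]mulrC.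
Qed.

Lemma smooth1_plateau : smooth1 (plateau e a b).
Proof.
rewrite (_ : plateau e a b = fun t => (step (e^-1 * t + (- a / e)) +
    step (- e^-1 * t + b / e)) + cst (-1) t); last by apply/funext => t; exact: plateauE.
apply: (smooth1D (fun t => _ + _) (cst (-1))); last exact: smooth1_cst.
by apply: smooth1D; exact/smooth1_affine/smooth1_step.
Qed.

Lemma is_derive_plateau (t : R) :
  is_derive t 1 (plateau e a b) (rkernel e a t - lkernel e b t).
Proof.
rewrite (_ : plateau e a b = fun t => (step (e^-1 * t + (- a / e)) +
    step (- e^-1 * t + b / e)) + cst (-1) t); last by apply/funext => s; exact: plateauE.
rewrite rkernelE lkernelE mul1r mulN1r opprK -[X in is_derive _ _ _ X]addr0.
have d1 := is_derive_step_affine e^-1 (- a / e) t.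
have d2 := is_derive_step_affine (- e^-1) (b / e) t.
have d3 : is_derive t 1 (cst (-1) : R -> R) 0 by exact: is_derive_cst.
exact: (is_deriveD (is_deriveD d1 d2) d3).
Qed.

Lemma plateau_bounds (t : R) : 0 <= plateau e a b t <= 1.
Proof.
have := step_ge0 ((t - a) / e); have := step_le1 ((t - a) / e).
have := step_ge0 ((b - t) / e); have := step_le1 ((b - t) / e).
rewrite /plateau => h1 h2 h3 h4; apply/andP; split; last lra.
have [ta|ta] := leP 2 ((t - a) / e).
  by rewrite (step_eq1 ((t - a) / e))//; lra.
rewrite (step_eq1 ((b - t) / e)); first lra.
rewrite ler_pdivlMr//; move: ta; rewrite ltr_pdivrMr// => ta.
by move: eab => h; lra.
Qed.

Lemma plateau_eq0 (t : R) : ~~ (a + e <= t <= b - e) -> plateau e a b t = 0.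
Proof.
have [eab' e0'] := (eab, e0).
rewrite negb_and -!ltNge /plateau => /orP[ta|tb].
  rewrite step_eq0 ?step_eq1 ?add0r ?subrr//.
    by rewrite ler_pdivlMr//; lra.
  by rewrite ler_pdivrMr//; lra.
rewrite addrC step_eq1 ?step_eq0; first lra.
  by rewrite ler_pdivrMr//; lra.
by rewrite ler_pdivlMr//; lra.
Qed.

End plateau.

Definition averaging_kernel2 (w : R * R -> R) (a b c d : R) : Prop :=
  [/\ 0 < c, continuous w,
      exists C : R, forall x, 0 <= w x <= C,
      (forall x, ~ box a b c d x -> w x = 0) &
      (\int[mu2]_(x in box a b c d) (w x)%:E = 1)%E].

Lemma averaging_kernel2_tensor (f g : R -> R) (a b c d C D : R) :
  averaging_kernel f a b C -> averaging_kernel g c d D -> 0 < c ->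
  averaging_kernel2 (tensor f g) a b c d.
Proof.
move=> [sf f0 fz fI] [sg g0 gz gI] c0.
have cf := smooth1_continuous _ sf; have cg := smooth1_continuous _ sg.
have mf := continuous_measurable_fun cf; have mg := continuous_measurable_fun cg.
split => //.
- exact: continuous_tensor.
- exists (C * D) => x; have /andP[f1 f2] := f0 x.1; have /andP[g1 g2] := g0 x.2.
  by rewrite /tensor mulr_ge0//= ler_pM.
- move=> x xB; rewrite /tensor.
  have [xab|/fz->] := boolP (a <= x.1 <= b); last by rewrite mul0r.
  by have [xcd|/gz->] := boolP (c <= x.2 <= d); [exfalso; exact: xB|rewrite mulr0].
- have fge t : 0 <= f t by have /andP[] := f0 t.
  have gge t : 0 <= g t by have /andP[] := g0 t.
  rewrite boxE setX_integral1//; last 2 first.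
  + apply/measurable_EFinP; apply: measurable_funTS.
    by apply: measurable_funM; exact: measurableT_comp.
  + by move=> x _; rewrite lee_fin mulr_ge0.
  rewrite -[RHS]fI; apply: eq_integral => t _; rewrite /tensor/=.
  under eq_integral do rewrite EFinM.
  rewrite ge0_integralZl//; last 3 first.
  + by apply/measurable_EFinP; exact: measurable_funTS.
  + by move=> s _; rewrite lee_fin.
  + by rewrite lee_fin.
  by rewrite gI mule1.
Qed.

End kernels.

(** * Increments of a function with a weak derivative *)

Section increments.
Variables (u w : R * R -> R) (a b c d C : R).
Hypotheses (lu : L1loc u) (c0 : 0 < c) (cw : continuous w).
Hypothesis wC : forall x, `|w x| <= C.
Hypothesis w0 : forall x, ~ box a b c d x -> w x = 0.

Lemma L1loc_integrable_boxM :
  mu2.-integrable (box a b c d) (fun x => (u x * w x)%:E).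
Proof.
have iu : mu2.-integrable (box a b c d) (fun x => (u x)%:E).
  by apply: lu; [exact: compact_box|exact: box_half_plane].
have mw : measurable_fun (box a b c d : set T2) w.
  by apply: measurable_funTS; exact: continuous_measurable2.
have bw : [bounded w x | x in box a b c d].
  exists C; split; first exact: num_real.
  by move=> D CD x _ /=; rewrite (le_trans (wC x))// ltW.
exact: (integrableMl (measurable_box a b c d) iu mw bw).
Qed.

Lemma half_plane_restrict_box :
  (fun x => (u x * w x)%:E) \_ (@half_plane R) =
  (fun x => (u x * w x)%:E) \_ (box a b c d).
Proof.
apply/funext => x; rewrite !patchE.
have [xB|xB] := pselect (box a b c d x).
  by rewrite !mem_set//; exact: box_half_plane xB.
rewrite w0// mulr0 (@memNset _ (box a b c d))//.
by case: ifP.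
Qed.

Lemma L1loc_integrableM :
  mu2.-integrable (@half_plane R) (fun x => (u x * w x)%:E).
Proof.
apply/(integrable_mkcond _ measurable_half_plane).
rewrite half_plane_restrict_box.
apply/(integrable_mkcond _ (measurable_box _ _ _ _)).
exact: L1loc_integrable_boxM.
Qed.

Lemma Rintegral_half_planeM :
  \int[mu2]_(x in @half_plane R) (u x * w x) =
  \int[mu2]_(x in box a b c d) (u x * w x).
Proof.
by rewrite /Rintegral integral_mkcond half_plane_restrict_box -integral_mkcond.
Qed.

End increments.

Section weak_derivative_increment.
Implicit Types (u g w eta : R * R -> R).

Lemma averaging_kernel2_bounded w (a b c d : R) : averaging_kernel2 w a b c d ->
  exists C : R, forall x, `|w x| <= C.
Proof.
move=> [_ _ [C wC] _ _]; exists C => x; have /andP[w0 ?] := wC x.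
by rewrite ger0_norm.
Qed.

Lemma averaging_kernel2_average u w (a b c d A del : R) :
  L1loc u -> averaging_kernel2 w a b c d ->
  (forall x, box a b c d x -> `|u x - A| <= del) ->
  `|\int[mu2]_(x in @half_plane R) (u x * w x) - A| <= del.
Proof.
move=> lu kw uA; have [C wC] := averaging_kernel2_bounded _ _ _ _ _ kw.
case: kw => [c0 cw [C' w0] wz wI].
rewrite (Rintegral_half_planeM _ _ _ _ _ _ c0 wz).
have iuw := L1loc_integrable_boxM _ _ a b _ d _ lu c0 cw wC.
have wge x : 0 <= w x by have /andP[] := w0 x.
have iw : mu2.-integrable (box a b c d) (EFin \o w).
  apply/integrableP; split.
    by apply/measurable_EFinP; apply: measurable_funTS; exact: continuous_measurable2.
  under eq_integral do rewrite /= ger0_norm//.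
  by rewrite wI ltry.
have wI' : \int[mu2]_(x in box a b c d) w x = 1 by rewrite /Rintegral wI.
have mB := measurable_box a b c d.
have iwZ (k : R) : mu2.-integrable (box a b c d) (EFin \o (fun x => k * w x)).
  rewrite (_ : EFin \o _ = fun x => k%:E * (EFin \o w) x)%E.
    exact: integrableZl.
  by apply/funext => x /=; rewrite EFinM.
have up : \int[mu2]_(x in box a b c d) (u x * w x) <= A + del.
  rewrite -[leRHS]mulr1 -wI' -RintegralZl//; apply: le_Rintegral => //.
  move=> x xB; rewrite ler_wpM2r//; have := uA x xB.
  by rewrite ler_norml => /andP[_]; rewrite lerBlDl.
have lo : A - del <= \int[mu2]_(x in box a b c d) (u x * w x).
  rewrite -[leLHS]mulr1 -wI' -RintegralZl//; apply: le_Rintegral => //.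
  move=> x xB; rewrite ler_wpM2r//; have := uA x xB.
  by rewrite ler_norml => /andP[+ _]; rewrite lerBrDl.
by rewrite ler_norml lerBlDl lerBrDl; apply/andP; split; [exact: lo|exact: up].
Qed.

(** Testing against [eta] compares averages of [u] near two points, where it is
    close to [A1] and [A2]. *)
Lemma weak_derivative_increment (e : R * R) u g eta w1 w2
    (a1 b1 c1 d1 a2 b2 c2 d2 a b c d A1 A2 C del : R) :
  is_weak_derivative e u g -> test_function eta ->
  (forall x, 'D_e eta x = w1 x - w2 x) ->
  averaging_kernel2 w1 a1 b1 c1 d1 -> averaging_kernel2 w2 a2 b2 c2 d2 ->
  (forall x, box a1 b1 c1 d1 x -> `|u x - A1| <= del) ->
  (forall x, box a2 b2 c2 d2 x -> `|u x - A2| <= del) ->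
  0 < c -> (forall x, ~ box a b c d x -> eta x = 0) ->
  (forall x, `|eta x| <= C) ->
  (`|A1 - A2|%:E <= (2 * del)%:E +
    \int[mu2]_(x in box a b c d) `|g x * eta x|%:E)%E.
Proof.
move=> [lu lg wd] teta Deta k1 k2 uA1 uA2 c0 eta0 etaC.
have v1 := averaging_kernel2_average _ _ _ _ _ _ _ _ lu k1 uA1.
have v2 := averaging_kernel2_average _ _ _ _ _ _ _ _ lu k2 uA2.
have [C1 wC1] := averaging_kernel2_bounded _ _ _ _ _ k1.
have [C2 wC2] := averaging_kernel2_bounded _ _ _ _ _ k2.
have i1 : mu2.-integrable (@half_plane R) (fun x => (u x * w1 x)%:E).
  by case: k1 => [p q _ r _]; exact: (L1loc_integrableM _ _ _ _ _ _ _ lu p q wC1 r).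
have i2 : mu2.-integrable (@half_plane R) (fun x => (u x * w2 x)%:E).
  by case: k2 => [p q _ r _]; exact: (L1loc_integrableM _ _ _ _ _ _ _ lu p q wC2 r).
have ceta := test_function_continuous _ teta.
have ig := L1loc_integrable_boxM _ _ a b _ d _ lg c0 ceta etaC.
have := wd _ teta; rewrite /leb2.
under eq_Rintegral do rewrite Deta mulrBr.
rewrite (RintegralB measurable_half_plane i1 i2).
rewrite (Rintegral_half_planeM g _ _ _ _ _ c0 eta0).
move: v1 v2.
set I1 := Rintegral _ _ _; set I2 := Rintegral _ _ _; set I := Rintegral _ _ _.
move=> v1 v2 E.
have gI : (`|I|%:E <= \int[mu2]_(x in box a b c d) `|g x * eta x|%:E)%E.
  rewrite /I (EFin_normr_Rintegral (measurable_box a b c d) ig).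
  by apply: le_abse_integral; [exact: measurable_box|exact: measurable_int ig].
apply: (@le_trans _ _ ((2 * del)%:E + `|I|%:E)%E); last by rewrite leeD2l.
rewrite -EFinD lee_fin.
have -> : A1 - A2 = (I2 - A2) - (I1 - A1) + (I1 - I2) by ring.
rewrite E (le_trans (ler_normD _ _))// normrN lerD2r.
by rewrite (le_trans (ler_normB _ _))// mulr_natl mulr2n lerD.
Qed.

End weak_derivative_increment.

(** * The stream function *)

Section stream_function_bounds.
Implicit Types (u psi : R * R -> R).

Lemma closed_half_plane_near psi (p1 p2 del : R) :
  {within @closed_half_plane R, continuous psi} -> 0 <= p2 -> 0 < del ->
  exists2 r : R, 0 < r & forall a b c d : R,
    p1 - r < a -> b < p1 + r -> p2 - r < c -> d < p2 + r -> 0 <= c ->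
    forall x, box a b c d x -> `|psi x - psi (p1, p2)| <= del.
Proof.
move=> cpsi p20 del0.
have : psi @ within (@closed_half_plane R) (nbhs (p1, p2)) --> psi (p1, p2).
  by move/subspace_continuousP : cpsi; exact.
move/cvgrPdist_le => /(_ _ del0) /nbhs_ballP[r /= r0 hr].
exists r => // a b c d ra rb rc rd c0 x [/andP[ax xb] /andP[cx xd]].
rewrite distrC; apply: hr; last exact: le_trans cx.
by split; rewrite -ball_normE/= distrC ltr_distl; apply/andP; split; lra.
Qed.

(** At the heights in [[e, 2 * e]] the bound of [approximable_box_bound] is of
    order [e] times the square root of [e], which beats the height [C / e] of the
    averaging kernel. *)
Lemma eq_boundary u psi (G a b : R) :
  approximable u G -> 0 < G -> {within @closed_half_plane R, continuous psi} ->
  is_weak_derivative (@e1 R) psi u -> a < b -> psi (a, 0) = psi (b, 0).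
Proof.
move=> hu G0 cpsi wpsi ab; have [C C0 hC] := @dstep_bounded R.
suff key (del : R) : 0 < del -> `|psi (a, 0) - psi (b, 0)| <= 3 * del.
  apply/eqP; rewrite -subr_eq0 -normr_le0; apply/ler_addgt0Pr => del del0.
  by rewrite add0r -[leRHS](@mulVKf _ 3)// key// mulr_gt0// invr_gt0.
move=> del0.
have [ra ra0 hra] := closed_half_plane_near _ a 0 del cpsi (lexx 0) del0.
have [rb rb0 hrb] := closed_half_plane_near _ b 0 del cpsi (lexx 0) del0.
have ba0 : 0 < b - a by rewrite subr_gt0.
(* With this choice the bound of [approximable_box_bound], multiplied by the
   height [C / e] of the kernel, is [del]. *)
pose B : R := del / (C * G); have B0 : 0 < B by rewrite divr_gt0// mulr_gt0.
have [e [e0 ea eb eab eB]] : exists e : R, [/\ 0 < e, 2 * e < ra, 2 * e < rb,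
    4 * e <= b - a & (b - a) * (2 * e) <= B ^+ 2].
  exists (Num.min (Num.min (ra / 4) (rb / 4))
    (Num.min ((b - a) / 4) (B ^+ 2 / (2 * (b - a))))).
  set e := Num.min _ _.
  have /and4P[h1 h2 h3 h4] : [&& e <= ra / 4, e <= rb / 4, e <= (b - a) / 4 &
      e <= B ^+ 2 / (2 * (b - a))].
    by rewrite /e !ge_min !lexx/= ?orbT.
  split; [|lra|lra|lra|].
    by rewrite /e !lt_min !divr_gt0// ?exprn_gt0// mulr_gt0.
  by rewrite (_ : _ * _ = e * (2 * (b - a))) -?ler_pdivlMr ?mulr_gt0//; ring.
have ka := kernel_rkernel C e a hC e0.
have kb := kernel_lkernel C e b hC e0.
have k0 := kernel_rkernel C e 0 hC e0.
have e00 : 0 < 0 + e by rewrite add0r.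
have sp := smooth1_plateau e a b.
have [sk _ k0z _] := k0.
set eta := tensor (plateau e a b) (rkernel e 0).
have teta : test_function eta.
  by apply: (test_function_tensor _ _ (a + e) (b - e) (0 + e) (0 + 2 * e)) => //;
    exact: plateau_eq0.
have eta0 x : ~ box (a + e) (b - e) (0 + e) (0 + 2 * e) x -> eta x = 0.
  move=> xB; rewrite /eta /tensor.
  have [x1|/(plateau_eq0 _ _ _ e0 eab)->] := boolP (a + e <= x.1 <= b - e);
    last by rewrite mul0r.
  have [x2|/k0z->] := boolP (0 + e <= x.2 <= 0 + 2 * e); last by rewrite mulr0.
  by exfalso; exact: xB.
have etaC x : `|eta x| <= C / e.
  have /andP[p0 p1] := plateau_bounds e a b e0 eab x.1.
  have [_ kC _ _] := k0; have /andP[q0 q1] := kC x.2.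
  rewrite /eta /tensor ger0_norm; last exact: mulr_ge0.
  by apply: (@le_trans _ _ (1 * (C / e))); [exact: ler_pM|rewrite mul1r].
have := weak_derivative_increment _ _ _ _ (tensor (rkernel e a) (rkernel e 0))
  (tensor (lkernel e b) (rkernel e 0)) _ _ _ _ _ _ _ _ _ _ _ _
  (psi (a, 0)) (psi (b, 0)) _ del wpsi teta _
  (averaging_kernel2_tensor _ _ _ _ _ _ _ _ ka k0 e00)
  (averaging_kernel2_tensor _ _ _ _ _ _ _ _ kb k0 e00)
  _ _ e00 eta0 etaC.
have Ce0 : 0 < C / e by rewrite divr_gt0.
move=> inc; rewrite -lee_fin; apply: (le_trans (inc _ _ _)).
- move=> x; rewrite (@derive_val _ _ _ _ _ _ _
    (is_derive_tensor1 _ _ _ x (is_derive_plateau e a b))).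
  by rewrite /tensor mulrBl.
- by apply: hra; lra.
- by apply: hrb; lra.
rewrite (_ : 3 * del = 2 * del + del)%R; last by ring.
rewrite EFinD leeD2l//.
have [measu _] := hu.
have mub : measurable_fun (box a b e (2 * e) : set T2) u.
  by apply: measurable_funS measu; [exact: measurable_half_plane|exact: box_half_plane].
apply: (@le_trans _ _ (\int[mu2]_(x in box a b e (2 * e)) ((C / e)%:E * `|u x|%:E))%E).
  rewrite !add0r in eta0 *.
  rewrite integral_mkcond [leRHS]integral_mkcond.
  apply: ge0_le_integral_nonmeasurable => x _.
    by apply: erestrict_ge0 => {}x _; rewrite lee_fin.
  rewrite [leLHS]patchE; case: ifPn => [/set_mem xB|_].
    rewrite patchE ifT; last first.
      apply/mem_set; case: xB => /andP[? ?] /andP[? ?].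
      by split; apply/andP; split; lra.
    by rewrite -EFinM lee_fin normrM mulrC ler_wpM2r.
  by apply: erestrict_ge0 => {}x _; rewrite -EFinM lee_fin mulr_ge0// ltW.
rewrite ge0_integralZl//; last 3 first.
- exact: measurable_box.
- by apply/measurable_EFinP; exact: measurableT_comp.
- by rewrite lee_fin ltW.
have := approximable_box_bound u G a b e (2 * e) B hu _ (ltW ab) B0 eB.
rewrite e0/= => /(_ _) H.
apply: (@le_trans _ _ ((C / e)%:E * ((2 * e - e) * (B * G))%:E)%E).
  by rewrite lee_wpmul2l ?lee_fin ?(ltW Ce0)//; apply: H; lra.
rewrite -EFinM lee_fin /B le_eqVlt; apply/orP; left; apply/eqP; field.
by rewrite !gt_eqF.
Qed.

(** The segment is cut at height one: below it the gradient suffices, which is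
    why the hypothesis on [A] is conditional. *)
Lemma vertical_bound u psi (G A y h : R) :
  approximable u G -> {within @closed_half_plane R, continuous psi} ->
  is_weak_derivative (@e2 R) psi (fun x => - u x) -> 0 < h -> 0 < A ->
  (1 < h -> (Xnormsq u <= (A ^+ 2)%:E)%E) ->
  `|psi (y, 0) - psi (y, h)| <= 2 * G + A * (if 1 < h then Num.sqrt (ln h) else 0).
Proof.
move=> hu cpsi wpsi h0 A0 uA; have [C C0 hC] := @dstep_bounded R.
apply/ler_addgt0Pr => eps eps0.
pose del : R := eps / 2; have del0 : 0 < del by rewrite divr_gt0.
have [r0 r00 hr0] := closed_half_plane_near _ y 0 del cpsi (lexx 0) del0.
have [r1 r10 hr1] := closed_half_plane_near _ y h del cpsi (ltW h0) del0.
have [e [e0 er0 er1 eh e1]] : exists e : R, [/\ 0 < e, 2 * e < r0, 2 * e < r1,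
    4 * e <= h - 0 & e <= 1].
  exists (Num.min (Num.min (r0 / 4) (r1 / 4)) (Num.min (h / 4) 1)).
  set e := Num.min _ _.
  have /and4P[h1 h2 h3 h4] : [&& e <= r0 / 4, e <= r1 / 4, e <= h / 4 & e <= 1].
    by rewrite /e !ge_min !lexx/= ?orbT.
  split; [|lra|lra|lra|lra].
  by rewrite /e !lt_min !divr_gt0//= ltr01.
have ky := kernel_rkernel C e y hC e0.
have k0 := kernel_rkernel C e 0 hC e0.
have kh := kernel_lkernel C e h hC e0.
have e00 : 0 < 0 + e by rewrite add0r.
have eh0 : 0 < h - 2 * e by lra.
have sp := smooth1_plateau e 0 h.
have [sk kC kz kI] := ky.
set eta := tensor (rkernel e y) (plateau e 0 h).
have teta : test_function eta.
  by apply: (test_function_tensor _ _ (y + e) (y + 2 * e) (0 + e) (h - e)) => //;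
    exact: plateau_eq0.
have eta0 x : ~ box (y + e) (y + 2 * e) (0 + e) (h - e) x -> eta x = 0.
  move=> xB; rewrite /eta /tensor.
  have [x1|/kz->] := boolP (y + e <= x.1 <= y + 2 * e); last by rewrite mul0r.
  have [x2|/(plateau_eq0 _ _ _ e0 eh)->] := boolP (0 + e <= x.2 <= h - e);
    last by rewrite mulr0.
  by exfalso; exact: xB.
have k_ge0 t : 0 <= rkernel e y t by have /andP[] := kC t.
have eta_le x : `|eta x| <= rkernel e y x.1.
  have /andP[p0 p1] := plateau_bounds e 0 h e0 eh x.2.
  rewrite /eta /tensor ger0_norm; last exact: mulr_ge0.
  by apply: (@le_trans _ _ (rkernel e y x.1 * 1)); [exact: ler_wpM2l|rewrite mulr1].
have etaC x : `|eta x| <= C / e.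
  by rewrite (le_trans (eta_le x))//; have /andP[] := kC x.1.
have := weak_derivative_increment _ _ _ _ (tensor (rkernel e y) (rkernel e 0))
  (tensor (rkernel e y) (lkernel e h)) _ _ _ _ _ _ _ _ _ _ _ _
  (psi (y, 0)) (psi (y, h)) _ del wpsi teta _
  (averaging_kernel2_tensor _ _ _ _ _ _ _ _ ky k0 e00)
  (averaging_kernel2_tensor _ _ _ _ _ _ _ _ ky kh eh0)
  _ _ e00 eta0 etaC.
move=> inc; rewrite -lee_fin; apply: (le_trans (inc _ _ _)).
- move=> x; rewrite (@derive_val _ _ _ _ _ _ _
    (is_derive_tensor2 _ _ _ x (is_derive_plateau e 0 h))).
  by rewrite /tensor mulrBr.
- by apply: hr0; lra.
- by apply: hr1; lra.
rewrite [(_ + eps)%R]addrC EFinD.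
rewrite (_ : 2 * del = eps)%R; last by rewrite /del mulrC divfK.
rewrite leeD2l//.
have mk : measurable_fun [set: T1] (rkernel e y).
  exact: continuous_measurable_fun (smooth1_continuous _ sk).
have kI1 : (\int[mu]_(t in `[(y + e)%R, (y + 2 * e)%R]) (rkernel e y t)%:E <= 1)%E.
  by rewrite kI.
have low := approximable_line_bound u G (rkernel e y) (y + e) (y + 2 * e) e (C / e) hu.
have {}low := low (introT andP (conj e0 e1)) mk kC kI1.
have [measu _] := hu.
set F := fun x : R * R => (`|u x| * rkernel e y x.1)%:E.
have F0 x : (0 <= F x)%E by rewrite lee_fin mulr_ge0.
apply: (@le_trans _ _ (\int[mu2]_(x in box (y + e) (y + 2 * e) (0 + e) (h - e)) F x)%E).
  apply: ge0_le_integral_nonmeasurable => x _; first by rewrite lee_fin.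
  by rewrite lee_fin normrM normrN ler_wpM2l.
have mF (D : set T2) : measurable D -> D `<=` @half_plane R -> measurable_fun D F.
  move=> mD DH; apply/measurable_EFinP; apply: measurable_funM.
    apply: measurableT_comp => //; apply: measurable_funS measu => //.
    exact: measurable_half_plane.
  by apply: measurable_funTS; exact: measurableT_comp.
set L := box (y + e) (y + 2 * e) e 1.
have mL : @measurable _ T2 L by exact: measurable_box.
have LH : L `<=` @half_plane R by exact: box_half_plane.
case: ifPn => [h1|]; last first.
  rewrite -leNgt mulr0 addr0 => h1; apply: le_trans low.
  apply: ge0_subset_integral => //; [exact: measurable_box|exact: mF|].
  by move=> x [xI /andP[? ?]]; split => //; apply/andP; split; lra.
set U := `[(y + e)%R, (y + 2 * e)%R]%classic `*` Ioc 1 h.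
have mU : @measurable _ T2 U.
  by apply: measurableX; [exact: measurable_itv|exact: measurable_Ioc].
have UH : U `<=` @half_plane R.
  by move=> x [_]; rewrite /Ioc/= in_itv/= => /andP[/(lt_trans ltr01)].
have high := tail_bound u (rkernel e y) _ _ h A measu mk k_ge0 kI1 h1 A0 (uA h1).
apply: (@le_trans _ _ (\int[mu2]_(x in L `|` U) F x)%E).
  apply: ge0_subset_integral => //.
  - exact: measurable_box.
  - exact: measurableU.
  - by apply: mF; [exact: measurableU|move=> x [/LH|/UH]].
  move=> x [xI /andP[x1 x2]]; have [x3|x3] := leP x.2 1.
    by left; split => //; apply/andP; split; lra.
  by right; split; rewrite /Ioc/= in_itv//= x3/=; lra.
rewrite ge0_integral_setU//.
- by rewrite EFinD leeD.
- by apply: mF; [exact: measurableU|move=> x [/LH|/UH]].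
- apply/disj_setPS => x [[_ /andP[_ x1]] [_]].
  by rewrite /Ioc/= in_itv/= => /andP[]; rewrite ltNge x1.
Qed.
End stream_function_bounds.

End plane.

Lemma approximable_component (R : realType) (u : R * R -> R)
    (phi_ : nat -> R * R -> R) (g eta : R) :
  Hdot1 u -> (forall k, test_function (phi_ k)) ->
  grad_L2_cvg phi_ u -> L2loc_cvg phi_ u ->
  grad_L2norm u = g%:E -> 0 < eta -> approximable u (g + eta).
Proof.
move=> hu tphi gphi lphi ug eta0.
have g0 : 0 <= g by rewrite -lee_fin -ug poweR_ge0.
apply: (approximable_limit _ _ _ hu _ _ tphi gphi lphi); first by rewrite ltr_wpDl.
by rewrite ug lee_fin lerDl ltW.
Qed.

Theorem lemma2p6 (R : realType) :
  exists N : R, 0 < N /\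
    forall (v : R * R -> R * R) (psi : R * R -> R) (x : R * R),
      (@Hdot1_0sigma R `&` @Xspace R) v ->
      stream_function v psi ->
      half_plane x ->
      (`|psi x|%:E <=
        N%:E * grad_L2norm (comp1 v) +
        Xnorm (comp1 v) *
          (if (1 < x.2)%R then Num.sqrt (ln x.2) else 0%R)%:E)%E.
Proof.
exists 2; split => // v psi [y h] [[H1 H2 [phi_ [tphi g1 g2 l1 l2]]] _]
  [cpsi psi0 w2 w1]; rewrite /half_plane/= => h0.
have [_ _ _ fin1] := H1; have [_ _ _ fin2] := H2.
have finE (z : \bar R) : (0 <= z -> z < +oo -> exists r, z = r%:E)%E.
  by case: z => // r _ _; exists r.
have [r1 E1] := finE (grad_L2norm (comp1 v)) (poweR_ge0 _ _) fin1.
have [r2 E2] := finE (grad_L2norm (comp2 v)) (poweR_ge0 _ _) fin2.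
have t1 k : test_function (comp1 (phi_ k)) by have [] := tphi k.
have t2 k : test_function (comp2 (phi_ k)) by have [] := tphi k.
have r20 : 0 <= r2 by rewrite -lee_fin -E2 poweR_ge0.
have bottom : psi (y, 0) = 0.
  have app2 := approximable_component _ _ _ _ 1 H2 t2 g2 l2 E2 ltr01.
  have eqb a b := eq_boundary _ _ _ a b app2 (ltr_wpDl r20 ltr01) cpsi w1.
  have [y0|y0|->//] := ltrgtP y 0; first by rewrite (eqb _ _ y0).
  by rewrite -(eqb _ _ y0).
have bound (eta A : R) : 0 < eta -> 0 < A ->
    (1 < h -> (Xnormsq (comp1 v) <= (A ^+ 2)%:E)%E) ->
    `|psi (y, h)| <= 2 * (r1 + eta) + A * (if 1 < h then Num.sqrt (ln h) else 0).
  move=> eta0 A0 hA; rewrite -normrN -[X in `|X|]add0r -[X in X - _]bottom.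
  have app1 := approximable_component _ _ _ _ _ H1 t1 g1 l1 E1 eta0.
  exact: (vertical_bound _ _ _ _ _ _ app1 cpsi w2 h0 A0 hA).
rewrite E1; case: ifPn bound => [h1|_] bound; last first.
  rewrite mule0 adde0 -EFinM lee_fin; apply/ler_addgt0Pr => eps eps0.
  apply: (le_trans (bound (eps / 2) 1 _ _ _)) => //; first by rewrite divr_gt0.
  by rewrite mulr0 addr0 mulrDr lerD2l mulrC divfK.
have L0 : 0 < Num.sqrt (ln h) by rewrite sqrtr_gt0 ln_gt0.
move: bound L0; set L := Num.sqrt _ => bound L0.
have X0 : (0 <= Xnorm (comp1 v))%E by exact: poweR_ge0.
case EX : (Xnorm (comp1 v)) X0 => [r|//|//] X0; last first.
  by rewrite gt0_mulye ?lte_fin// addey ?leey// -EFinM.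
rewrite lee_fin in X0.
rewrite -!EFinM -EFinD lee_fin; apply/ler_addgt0Pr => eps eps0.
have L20 : 0 < 2 + L by rewrite addr_gt0.
have eta0 : 0 < eps / (2 + L) by rewrite divr_gt0.
apply: (le_trans (bound _ (r + eps / (2 + L)) eta0 _ _)) => //.
- by rewrite ltr_wpDl.
- move=> _; apply: poweR_half_le.
  + apply: integral_ge0 => s /=; rewrite in_itv/= andbT => s0.
    by apply: mule_ge0; [rewrite lee_fin ltW|apply: mule_ge0; exact: slice_Linfty_ge0].
  + by rewrite addr_ge0// ltW.
  + by rewrite -/(Xnorm _) EX lee_fin lerDl ltW.
rewrite le_eqVlt; apply/orP; left; apply/eqP; field.
by rewrite gt_eqF.
Qed.
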